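(* Let $\mathbb{K}$ be a field, let $\mathcal{C}$ be a $d$-uniform clutter on $[n]$ and let $\mathcal{D}$ be a simplicial subclutter of $\mathcal{C}$. Consider the ideals $I(\bar{\mathcal{C}})$ and $I(\bar{\mathcal{D}})$ in $S=\mathbb{K}[x_1,\ldots,x_n]$. Then (a) the ideal $I(\bar{\mathcal{C}})$ satisfies the subadditivity condition if and only if the ideal $I(\bar{\mathcal{D}})$ does so. (b) the ideal $I(\bar{\mathcal{C}})$ has a special Betti diagram if and only if $I(\bar{\mathcal{D}})$ does so.
   Context: $[n]=\{1,\ldots,n\}$. A $d$-uniform clutter $\mathcal{C}$ on $[n]$ is a collection of $d$-element subsets of $[n]$; $\bar{\mathcal{C}}$ is the collection of all $d$-subsets of $[n]$ not in $\mathcal{C}$. For $T\subseteq[n]$, $\mathbf{x}_T=\prod_{i\in T}x_i$; $I(\mathcal{C})=(\mathbf{x}_T : T\in\mathcal{C})$, with $I(\varnothing)=0$. A subset $G\subseteq[n]$ is a clique of $\mathcal{C}$ if $|G|<d$ or all $d$-subsets of $G$ belong to $\mathcal{C}$. For a $(d-1)$-subset $e$ of $[n]$, $N_{\mathcal{C}}[e]=e\cup\{c\in[n] : e\cup\{c\}\in\mathcal{C}\}$, and $e$ is simplicial over $\mathcal{C}$ if $N_{\mathcal{C}}[e]$ is a clique of $\mathcal{C}$. A subclutter $\mathcal{D}\subsetneq\mathcal{C}$ is a simplicial subclutter of $\mathcal{C}$ if there exist $(d-1)$-subsets $e_1,\ldots,e_t$ of $[n]$ (not necessarily distinct) and sets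 $A_i\subseteq\{F\in\mathcal{C}\setminus A_1\setminus\cdots\setminus A_{i-1} : e_i\subset F\}$, $i=1,\ldots,t$, such that $e_1$ is simplicial over $\mathcal{C}$, $e_i$ is simplicial over $\mathcal{C}\setminus A_1\setminus\cdots\setminus A_{i-1}$ for $i>1$, and $\mathcal{D}=\mathcal{C}\setminus A_1\setminus\cdots\setminus A_t$. For a homogeneous ideal $I\subset S$ (standard $\mathbb{Z}$-grading), $t_i(I)=\max\{j : \mathrm{Tor}_i^S(\mathbb{K},S/I)_j\neq0\}$, with $t_i(I)=-\infty$ if $\mathrm{Tor}_i^S(\mathbb{K},S/I)=0$, and $r_i(I)=t_i(I)-i$. The ideal $I$ satisfies the subadditivity condition if $t_{i+j}(I)\leq t_i(I)+t_j(I)$ for all $i,j$ with $i+j\leq\mathrm{pd}(S/I)$, where $\mathrm{pd}$ denotes projective dimension. Let $c=\mathrm{reg}(S/I)=\max_i r_i(I)$. The ideal $I$ has a special Betti diagram (the Betti diagram of $S/I$ has a special shape) if (i) $r_0(I)\leq r_1(I)\leq\cdots\leq r_g(I)$, where $g$ is the smallest integer with $r_g(I)=c$, and (ii) $r_{i+1}(I)\leq r_i(I)$ for $g\leq i\leq\mathrm{pd}(S/I)$. *)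

(* Defs.v *)
From HB Require Import structures.
From mathcomp Require Import all_boot all_order all_algebra.
From mathcomp Require Import classical_sets constructive_ereal.
(* The notations of mpoly clash with those of classical_sets. *)
From mathcomp Require Import -(notations) mpoly.

Set Implicit Arguments.
Unset Strict Implicit.
Unset Printing Implicit Defensive.

Import Order.TTheory GRing.Theory Num.Theory.
Local Open Scope ring_scope.

(** ** Clutters on the vertex set 'I_n, which stands for [n] = {1, ..., n} *)

Section Clutters.
Variables (n d : nat).
Implicit Types (C D A : {set {set 'I_n}}) (e F G : {set 'I_n}).

Definition uniform C : Prop := forall F, F \in C -> #|F| = d.

Definition clutter_compl C : {set {set 'I_n}} :=
  [set F : {set 'I_n} | (#|F| == d) && (F \notin C)].

Definition clique C G : Prop :=
  (#|G| < d)%N \/ forall F, F \subset G -> #|F| = d -> F \in C.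

Definition clnbhd C e : {set 'I_n} :=
  e :|: [set c : 'I_n | (c |: e) \in C].

(* [#|e|.+1 = d] rather than [#|e| = d.-1], so that there is no
   (d-1)-subset when d = 0. *)
Definition simplicial C e : Prop := #|e|.+1 = d /\ clique C (clnbhd C e).

(* [s] is the list of the pairs (e_1, A_1), ..., (e_t, A_t). *)
Fixpoint simplicial_elim C (s : seq ({set 'I_n} * {set {set 'I_n}})) D : Prop :=
  if s is (e, A) :: s' then
    [/\ simplicial C e,
        A \subset [set F in C | e \subset F] &
        simplicial_elim (C :\: A) s' D]
  else D = C.

(* As [D] is a proper subclutter, the empty elimination is excluded. *)
Definition simplicial_subclutter D C : Prop :=
  D \proper C /\ exists s, simplicial_elim C s D.

End Clutters.

(** ** Graded Betti numbers of S/I, for S = K[x_1, ..., x_n] *)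

Section Graded.
Variables (K : fieldType) (n : nat).
Local Notation S := (mpoly n K).

Definition sqfree_monomial (T : {set 'I_n}) : S :=
  \prod_(i in T) mpolyX K (mnm1 i).

Definition circuit_ideal (C : {set {set 'I_n}}) (f : S) : Prop :=
  exists h : {set 'I_n} -> S, f = \sum_(T in C) h T * sqfree_monomial T.

Implicit Type I : S -> Prop.

(* The zero polynomial is homogeneous of every degree; the degree ranges
   over [int] because the twists of a graded free module do. *)
Definition homog (a : int) (p : S) : Prop :=
  forall m, m \in msupp p -> (mdeg m)%:Z = a.

(* A sequence F_0 <- F_1 <- ... of graded free modules of finite rank,
   F_i = \bigoplus_k S(- deg i k), whose elements are row vectors on which the
   maps [dif i] : F_{i+1} -> F_i act on the right, together with a lift
   [aug] : F_0 -> S of a map F_0 -> S/I. *)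
Record graded_free := GradedFree {
  rk : nat -> nat;
  deg : forall i, 'I_(rk i) -> int;
  dif : forall i, 'M[S]_(rk i.+1, rk i);
  aug : 'cV[S]_(rk 0)
}.

Definition is_graded (F : graded_free) : Prop :=
  (forall k, homog (@deg F 0 k) (aug F k 0)) /\
  (forall i k l, homog (@deg F i.+1 k - @deg F i l) (dif F i k l)).

(* ... -> F_1 -> F_0 -> S/I -> 0 is exact; the three clauses are exactness at
   S/I, at F_0 and at F_{i+1}. *)
Definition exact_over I (F : graded_free) : Prop :=
  [/\ forall f : S, exists v : 'rV[S]_(rk F 0), I (f - (v *m aug F) 0 0),
      forall v : 'rV[S]_(rk F 0),
        I ((v *m aug F) 0 0) <-> exists w, v = w *m dif F 0 &
      forall i (v : 'rV[S]_(rk F i.+1)),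
        v *m dif F i = 0 <-> exists w, v = w *m dif F i.+1].

Definition is_graded_resolution I F : Prop := is_graded F /\ exact_over I F.

(* The differentials of the complex F (x)_S K, where K = S/(x_1, ..., x_n):
   reduction modulo (x_1, ..., x_n) is the constant coefficient. *)
Definition res_dif (F : graded_free) i : 'M[K]_(rk F i.+1, rk F i) :=
  map_mx (mcoeff mnm0) (dif F i).

Definition res_cycle (F : graded_free) i : 'rV[K]_(rk F i) -> Prop :=
  match i with
  | 0 => fun=> True
  | i'.+1 => fun v => v *m res_dif F i' = 0
  end.

Definition res_boundary (F : graded_free) i (v : 'rV[K]_(rk F i)) : Prop :=
  exists w, v = w *m res_dif F i.

(* Tor_i^S(K, S/I)_j <> 0: a graded free resolution F of S/I has a cycle of
   degree j in F_i (x) K which is not a boundary.  Whether this holds does not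
   depend on the choice of F. *)
Definition Tor_neq0 I (i : nat) (j : int) : Prop :=
  exists2 F, is_graded_resolution I F &
  exists v : 'rV[K]_(rk F i),
    [/\ forall k, v 0 k != 0 -> deg k = j,
        res_cycle v & ~ res_boundary v].

(* m <= pd (S/I): every graded free resolution of S/I has length at least m. *)
Definition le_pd (m : nat) I : Prop :=
  forall F p, is_graded_resolution I F ->
    (forall i, (p < i)%N -> rk F i = 0) -> (m <= p)%N.

(* The maximum of a set, and -oo for the empty set. *)
Definition emax (A : \bar int -> Prop) : \bar int :=
  xget -oo%E (fun x => A x /\ forall y, A y -> (y <= x)%E).

Definition tmax I (i : nat) : \bar int :=
  emax (fun x => exists2 j, Tor_neq0 I i j & x = j%:E).

Definition rmax I (i : nat) : \bar int := (tmax I i - (i%:Z)%:E)%E.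

Definition reg I : \bar int := emax (fun x => exists i, x = rmax I i).

Definition subadditive I : Prop :=
  forall i j, le_pd (i + j) I -> (tmax I (i + j) <= tmax I i + tmax I j)%E.

Definition special_betti I : Prop :=
  exists g : nat,
    [/\ rmax I g = reg I,
        forall i, (i < g)%N -> rmax I i <> reg I,
        forall i, (i < g)%N -> (rmax I i <= rmax I i.+1)%E &
        forall i, (g <= i)%N -> le_pd i I -> (rmax I i.+1 <= rmax I i)%E].

End Graded.

Arguments circuit_ideal K {n} C f.

(* Main.v *)
Require Import Defs.
From mathcomp Require Import all_boot all_order all_algebra.
From mathcomp Require Import mpoly zify ring.
From mathcomp Require Import -(notations) boolp constructive_ereal.
From mathcomp Require classical_sets.

(* Tor_i(S/I)_j is computed on any graded free resolution of S/I: by dimension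
   shifting along the syzygy modules it is the i-th Koszul homology of S/I in
   degree j.  For I = I(\bar C) the latter splits over the squarefree
   multidegrees W with |W| = j into the cohomology of the clique complex of C
   restricted to W (Hochster's formula).  Removing a circuit F that contains a
   simplicial e removes from this complex the interval [F, N[e]], which is
   acyclic unless N[e] = F, and then F is the only facet through e; so the
   cohomology on faces of size at least d, which is the part of the Betti table
   above the linear strand, does not change.  Both properties depend only on
   that part: a column of the Betti table starts at the linear strand, and the
   non-zero columns are consecutive by the rigidity of Koszul homology. *)

Set Implicit Arguments.
Unset Strict Implicit.
Unset Printing Implicit Defensive.

Import Order.TTheory GRing.Theory Num.Theory.
Local Open Scope ring_scope.

(** * The complex of functions on the subsets of a finite set *)

Section BooleanComplex.
Variables (T : finType) (R : comNzRingType).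
Implicit Types (U W : {set T}) (u v w : T) (c y : {set T} -> R).

(** [Tor_neq0] asks for one resolution while [le_pd] quantifies over all of them, so two facts are
    needed: independence of the resolution, and existence of one, for which the Taylor complex is
    taken. Taylor and Koszul complexes both split over multidegrees into complexes of functions on
    finite sets, so all homology is reduced to [bnd] and treated by explicit primitives, mostly
    built with [cone], instead of long exact sequences. The linear strand is j = i + d - 1. An
    exterior part U of size i leaves the face W :\: U of size j - i, so j >= i + d selects exactly
    the faces with at least d vertices. Below this threshold the two tables may really differ, and
    so may the projective dimensions: the complete clutter has ideal 0, and removing one circuit
    gives a principal ideal. Hence columns are compared only where both are non-zero, and a maximum
    lying on the linear strand is treated by a numerical bound. *)

Definition inc_sign v U : R :=
  (-1) ^+ #|[set u in U | (enum_rank u < enum_rank v)%N]|.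

Lemma inc_sign_sqr v U : inc_sign v U * inc_sign v U = 1.
Proof. by rewrite -expr2 sqrr_sign. Qed.

Lemma inc_signU1 u v U : v \notin U ->
  inc_sign u (v |: U) = inc_sign u U * (-1) ^+ (enum_rank v < enum_rank u)%N.
Proof.
move=> vU; rewrite /inc_sign -exprD; congr (_ ^+ _).
case: ltnP => [lt_vu | ge_vu] /=.
  rewrite addn1 (cardsD1 v) !inE eqxx lt_vu add1n; congr _.+1.
  apply: eq_card => x; rewrite !inE; case: eqP => // -> /=.
  by rewrite (negbTE vU).
rewrite addn0; apply: eq_card => x; rewrite !inE.
case: eqP => // ->; by rewrite [(_ < _)%N]ltnNge ge_vu !andbF.
Qed.

Lemma inc_sign_swap u v U : u != v -> u \notin U -> v \notin U ->
  inc_sign v (u |: U) * inc_sign u (v |: U) = - (inc_sign u U * inc_sign v U).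
Proof.
move=> uv uU vU; rewrite !inc_signU1 // mulrACA -signr_addb.
have -> : (enum_rank u < enum_rank v)%N (+) (enum_rank v < enum_rank u)%N = true.
  by case: ltngtP => // /ord_inj/enum_rank_inj e; rewrite e eqxx in uv.
by rewrite mulrN1 mulrC.
Qed.

Lemma inc_sign_anti u v U : u != v -> u \notin U -> v \notin U ->
  inc_sign v U * inc_sign u (v |: U) = - (inc_sign u U * inc_sign v (u |: U)).
Proof.
move=> uv uU vU; rewrite !inc_signU1 // mulrCA -mulrN; congr (_ * _).
have: (enum_rank u < enum_rank v)%N (+) (enum_rank v < enum_rank u)%N = true.
  by case: ltngtP => // /ord_inj/enum_rank_inj e; rewrite e eqxx in uv.
by case: ltngtP => //= _ _; rewrite !(mulr1, expr0, expr1) mulrN1 ?opprK.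
Qed.

(** The simplicial boundary on coordinates: the value at [U] collects those at sets one element
    larger, so it lowers the homological degree by one. *)
Definition bnd W c U : R :=
  \sum_(v in W :\: U) inc_sign v U * c (v |: U).

(** Exterior multiplication by [w], the usual contracting homotopy of a simplex. *)
Definition cone w c U : R :=
  if w \in U then inc_sign w (U :\ w) * c (U :\ w) else 0.

Lemma eq_bnd W c y U : (forall v, v \in W -> v \notin U -> c (v |: U) = y (v |: U)) ->
  bnd W c U = bnd W y U.
Proof.
by move=> e; apply: eq_bigr => v; rewrite inE => /andP[vU vW]; rewrite e.
Qed.

Lemma bnd0 W c U : (forall v, v \in W -> v \notin U -> c (v |: U) = 0) ->
  bnd W c U = 0.
Proof.
by move=> e; rewrite /bnd big1 // => v; rewrite inE => /andP[vU vW]; rewrite e ?mulr0.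
Qed.

Lemma bndB W c y U : bnd W (fun V => c V - y V) U = bnd W c U - bnd W y U.
Proof. by rewrite /bnd -sumrB; apply: eq_bigr => v _; rewrite mulrBr. Qed.

Lemma bndD W c y U : bnd W (fun V => c V + y V) U = bnd W c U + bnd W y U.
Proof. by rewrite /bnd -big_split; apply: eq_bigr => v _; rewrite mulrDr. Qed.

Lemma bnd_cone W w c U : w \in W ->
  bnd W (cone w c) U + cone w (bnd W c) U = c U.
Proof.
move=> wW; rewrite {2}/cone; case: ifPn => [wU | wU]; last first.
  rewrite addr0 /bnd (bigD1 w) ?inE ?wU //= big1 ?addr0 => [|v].
    by rewrite /cone setU11 setU1K // mulrA inc_sign_sqr mul1r.
  rewrite !inE => /andP[/andP[vU vW] vw].
  by rewrite /cone !inE eq_sym (negbTE vw) (negbTE wU) mulr0.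
set U' := U :\ w; have wU' : w \notin U' by rewrite !inE eqxx.
have defU : w |: U' = U by rewrite setD1K.
rewrite /bnd [X in _ * X](bigD1 w) /= ?inE ?eqxx //=.
rewrite mulrDr mulrA inc_sign_sqr mul1r defU addrCA -[RHS]addr0; congr (_ + _).
rewrite mulr_sumr (eq_bigl (mem (W :\: U)) (fun i => inc_sign w U' * _)); last first.
  move=> v; rewrite !inE; case: (v =P w) => [->|_]; last by rewrite andbT.
  by rewrite wU andbF.
rewrite -big_split /= big1 // => v; rewrite inE => /andP[vU vW].
have vw : v != w by apply: contraNneq vU => ->.
have vU' : v \notin U' by rewrite !inE (negbTE vU) andbF.
have -> : cone w c (v |: U) = inc_sign w (v |: U') * c (v |: U').
  rewrite /cone !inE wU orbT; suff -> : (v |: U) :\ w = v |: U' by [].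
  by rewrite setDUl; congr (_ :|: _); apply/setDidPl; rewrite disjoints1 inE.
rewrite -[in inc_sign v U]defU mulrA mulrA -mulrDl.
by rewrite mulrC inc_sign_swap 1?eq_sym // mulrC ?mulNr addNr ?mulr0 ?mul0r.
Qed.

Lemma bnd_bnd W c U : bnd W (bnd W c) U = 0.
Proof.
pose t (u v : T) := inc_sign v U * inc_sign u (v |: U) * c (u |: (v |: U)).
pose D := W :\: U.
have -> : bnd W (bnd W c) U = \sum_(v in D) \sum_(u in D | u != v) t u v.
  apply: eq_bigr => v _; rewrite mulr_sumr; apply: eq_big => [u|u _].
    by rewrite !inE negb_or -andbA andbC.
  by rewrite /t mulrA.
pose lt (u v : T) := (enum_rank u < enum_rank v)%N.
have -> : \sum_(v in D) \sum_(u in D | u != v) t u v =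
  \sum_(v in D) \sum_(u in D | lt u v) t u v
  + \sum_(v in D) \sum_(u in D | lt v u) t u v.
  rewrite -big_split; apply: eq_bigr => v _; rewrite (bigID (lt^~ v)) /=.
  congr (_ + _); apply: eq_bigl => u; rewrite -andbA; congr (_ && _).
    by rewrite /lt; case: eqP => // ->; rewrite ltnn.
  rewrite /lt -leqNgt leq_eqVlt; case: (u =P v) => [->|ne]; first by rewrite ltnn.
  by case: eqP => // /ord_inj/enum_rank_inj/esym.
rewrite [X in _ + X](exchange_big_dep (mem D)) => [|v u _ /andP[]] //=.
rewrite -big_split big1 //= => v vD.
rewrite [X in _ + X](eq_bigl (fun u => (u \in D) && lt u v)); last first.
  by move=> u; rewrite vD.
rewrite -big_split big1 //= => u /andP[uD ltuv].
have uv : u != v by apply: contraTneq ltuv => ->; rewrite /lt ltnn.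
move: uD vD; rewrite !inE => /andP[uU _] /andP[vU _].
by rewrite /t inc_sign_anti // setUCA mulNr addNr.
Qed.

(* Exactness in homological degree [p], the size of the subsets, of the complex
   with differential [bnd W] and basis the subsets [U] of [W] with [act U]. *)
Definition exact_at (act : pred {set T}) W (p : nat) : Prop :=
  forall c, (forall U, U \subset W -> act U -> #|U|.+1 = p -> bnd W c U = 0) ->
  exists y, forall U, U \subset W -> act U -> #|U| = p -> c U = bnd W y U.

(** The error term [cone w (bnd W c)] of the homotopy reads [bnd W c] at [U :\ w]; the hypothesis
    keeps this set active, where [c] is a cycle. *)
Lemma exact_at_cone (act : pred {set T}) W p w : w \in W ->
  (forall U, U \subset W -> act U -> #|U| = p -> w \in U -> act (U :\ w)) ->
  exact_at act W p.
Proof.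
move=> wW actD c cyc; exists (cone w c) => U sUW aU sz.
rewrite -[LHS](bnd_cone c U wW) /cone; case: ifPn => [wU|]; last by rewrite addr0.
rewrite cyc ?mulr0 ?addr0 ?actD //; first by rewrite subDset subsetU // sUW orbT.
by rewrite -sz (cardsD1 w U) wU.
Qed.

Lemma eq_exact_at (act act' : pred {set T}) W p :
  (forall U, U \subset W -> act U = act' U) -> exact_at act W p -> exact_at act' W p.
Proof.
move=> e ex c cyc; have [U sU aU|y yP] := ex c; first by apply: cyc => //; rewrite -e.
by exists y => U sU aU; apply: yP => //; rewrite e.
Qed.

Lemma exact_at_large (act : pred {set T}) W p : (#|W| < p)%N -> exact_at act W p.
Proof.
move=> ltWp c _; exists c => U sUW _ sz.
by move: (subset_leq_card sUW); rewrite leqNgt sz ltWp.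
Qed.

End BooleanComplex.

(** * Rigidity *)

Section Rigidity.
Variables (T : finType) (R : comNzRingType).
Implicit Types (U W V s : {set T}) (u v w : T) (c y : {set T} -> R).

(** The part of the differential that removes [v]. It presents the complex of [v |: W] as the
    mapping cone of multiplication by the variable [v]. *)
Definition slice v c U : R := inc_sign R v U * c (v |: U).

Lemma bnd_setU1 v W c U : v \notin U -> v \notin W ->
  bnd (v |: W) c U = slice v c U + bnd W c U.
Proof.
move=> vU vW; rewrite /bnd (bigD1 v) /= ?inE ?eqxx ?vU //; congr (_ + _).
apply: eq_bigl => u; rewrite !inE; case: (u =P v) => [->|_].
  by rewrite (negbTE vW) !andbF.
by rewrite andbT.
Qed.

Lemma bnd_setU1_in v W c U : v \in U -> bnd (v |: W) c U = bnd W c U.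
Proof.
move=> vU; apply: eq_bigl => u; rewrite !inE.
by case: (u =P v) => [->|//]; rewrite vU.
Qed.

Lemma bnd_slice v W c U : v \notin U -> v \notin W ->
  bnd W (slice v c) U = - (inc_sign R v U * bnd (v |: W) c (v |: U)).
Proof.
move=> vU vW; rewrite bnd_setU1_in ?setU11 // /bnd mulr_sumr -sumrN.
apply: eq_big => u.
  rewrite !inE negb_or; case: (u =P v) => [->|//].
  by rewrite (negbTE vW) andbF.
rewrite inE => /andP[uU uW]; have uv : u != v by apply: contraNneq vW => <-.
by rewrite /slice setUCA !mulrA -mulNr inc_sign_anti // eq_sym.
Qed.

Lemma disjoint_setU1 v (A B : {set T}) :
  [disjoint v |: A & B] = (v \notin B) && [disjoint A & B].
Proof. by rewrite !disjoints_subset subUset sub1set inE. Qed.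

Lemma slice_cone v c U : v \notin U -> slice v (cone v c) U = c U.
Proof.
by move=> vU; rewrite /slice /cone setU11 setU1K // mulrA inc_sign_sqr mul1r.
Qed.

(* The homology at [p] of the complex of [W] with faces linked by [s] is that of
   the Koszul complex of the variables of [W] on the face ring in the
   multidegree [s :|: W]; this is the rigidity of Koszul homology, and the two
   cases [v \in s] and [v \notin s] play the role of Nakayama's lemma. *)
Lemma exact_at_rigid (face : pred {set T}) p V :
  (forall s s', s \subset s' -> face s' -> face s) ->
  (forall s W, [disjoint s & V] -> W \subset V ->
     exact_at R (fun U => face (s :|: (W :\: U))) W p) ->
  forall s W, [disjoint s & V] -> W \subset V ->
     exact_at R (fun U => face (s :|: (W :\: U))) W p.+1.
Proof.
move=> faceD; move: {2}#|V| (erefl #|V|) => m; elim: m V => [|m IH] V cardV exV s W.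
  move=> _ sWV; apply: exact_at_large.
  by move: (subset_leq_card sWV); rewrite cardV leqn0 => /eqP->.
have [v vV] : exists v, v \in V by apply/set0Pn; rewrite -card_gt0 cardV.
pose V' := V :\ v.
have cardV' : #|V'| = m by move: cardV; rewrite (cardsD1 v) vV => -[].
have ex0 s1 W1 : [disjoint s1 & V'] -> W1 \subset V' -> v \notin s1 ->
    exact_at R (fun U => face (s1 :|: (W1 :\: U))) W1 p.
  move=> dis sub vs1; apply: exV; last exact: subset_trans sub (subsetDl _ _).
  by rewrite -(setD1K vV) disjoint_sym disjoint_setU1 vs1 disjoint_sym.
(* Once [v] has left [V], the set [s1] may contain it. A cycle there, extended by zero to [z],
   bounds in [v |: W1]; the slice of the primitive is a cycle in the multidegree without [v], so
   [ex0] bounds it in turn. *)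
have ex1 s1 W1 : [disjoint s1 & V'] -> W1 \subset V' ->
    exact_at R (fun U => face (s1 :|: (W1 :\: U))) W1 p.
  move=> dis sub; case: (boolP (v \in s1)) => vs1; last exact: ex0.
  have vW1 : v \notin W1 by apply/negP => /(subsetP sub); rewrite !inE eqxx.
  have vs' : v \notin s1 :\ v by rewrite !inE eqxx.
  have dis' : [disjoint s1 :\ v & V'] by apply: disjointWl dis; apply: subsetDl.
  have act1 U : v \notin U -> (s1 :\ v) :|: ((v |: W1) :\: U) = s1 :|: (W1 :\: U).
    move=> vU; apply/setP=> x; rewrite !inE; case: (x =P v) => [->|//].
    by rewrite vs1 vU.
  have act2 U : (s1 :\ v) :|: ((v |: W1) :\: (v |: U)) = (s1 :\ v) :|: (W1 :\: U).
    apply/setP=> x; rewrite !inE; case: (x =P v) => [->|//] /=.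
    by rewrite (negbTE vW1) andbF.
  move=> c cyc; pose z U := if v \in U then 0 else c U.
  have slz U : slice v z U = 0 by rewrite /slice /z setU11 mulr0.
  have bz U : v \notin U -> bnd W1 z U = bnd W1 c U.
    move=> vU; apply: eq_bnd => u uW uU; rewrite /z !inE (negbTE vU) orbF.
    by case: eqP => // e; rewrite e uW in vW1.
  have dis1 : [disjoint s1 :\ v & V].
    by rewrite -(setD1K vV) disjoint_sym disjoint_setU1 vs' disjoint_sym.
  have sub1 : v |: W1 \subset V by rewrite -(setD1K vV) setUS.
  have [U sU aU sz|y yP] := exV _ _ dis1 sub1 z.
     case: (boolP (v \in U)) => vU.
      by apply: bnd0 => u _ _; rewrite /z !inE vU orbT.
    rewrite bnd_setU1 // slz add0r bz // cyc // -?act1 //.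
    by rewrite -(setU1K vW1) subsetD1 sU.
  have [U sU aU sz|t tP] := ex0 _ _ dis' sub vs' (slice v y).
    have vU : v \notin U by apply/negP => /(subsetP sU); rewrite (negbTE vW1).
    rewrite bnd_slice // -yP ?mulr0 ?oppr0 // ?act2 // ?setUS //.
      by rewrite /z setU11 mulr0 oppr0.
    by rewrite cardsU1 vU.
  exists (fun U => t U + y U) => U sU aU sz.
  have vU : v \notin U by apply/negP => /(subsetP sU); rewrite (negbTE vW1).
  rewrite bndD -tP // -?bnd_setU1 // -?yP ?act1 //.
  - by rewrite /z (negbTE vU).
  - exact: subset_trans sU (subsetUr _ _).
  - by apply: faceD aU; rewrite setSU // subsetDl.
have {}IH := IH _ cardV' ex1.
move=> dis sub; have vs : v \notin s.
  by apply/negP => vs; move/pred0P: dis => /(_ v); rewrite /= vs vV.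
have dis' : [disjoint s & V'] by apply: disjointWr dis; apply: subsetDl.
case: (boolP (v \in W)) => vW; last first.
  by apply: IH => //; rewrite subsetD1 sub.
pose W' := W :\ v; have vW' : v \notin W' by rewrite !inE eqxx.
have defW : v |: W' = W by rewrite setD1K.
have subW' : W' \subset V' by rewrite setSD.
have act1 U : v \notin U -> (v |: s) :|: (W' :\: U) = s :|: (W :\: U).
  move=> vU; rewrite -defW; apply/setP=> x; rewrite !inE.
  by case: (x =P v) => [->|//] /=; rewrite vU orbT.
have act2 U : W :\: (v |: U) = W' :\: U.
  rewrite -defW; apply/setP=> x; rewrite !inE; case: (x =P v) => [->|//] /=.
  by rewrite andbF.
move=> c cyc.
have [U sU aU sz|t tP] := ex0 _ _ dis' subW' vs (slice v c).
  have vU : v \notin U by apply/negP => /(subsetP sU); rewrite (negbTE vW').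
  rewrite bnd_slice // defW cyc ?mulr0 ?oppr0 // ?act2 //.
    by rewrite -defW setUS.
  by rewrite cardsU1 vU add1n sz.
(* Since [t] bounds the slice of [c], this homologous cycle has zero slice. It is thus a cycle on
   the sets avoiding [v], whose complements contain [v]: induction applies with [v] moved into
   [s]. *)
pose z U := c U + bnd W (cone v t) U.
have slz U : U \subset W' -> face (s :|: (W' :\: U)) -> #|U| = p -> slice v z U = 0.
  move=> sU aU sz; have vU : v \notin U by apply/negP => /(subsetP sU); rewrite (negbTE vW').
  rewrite /slice /z mulrDr -/(slice v c U) tP // -[W in bnd W (cone _ _)]defW.
  rewrite -[X in _ + X]opprK -bnd_slice // (@eq_bnd _ _ _ _ t) ?subrr // => u uW uU.
  by rewrite slice_cone // !inE negb_or vU andbT; apply: contraNneq vW' => ->.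
have disv : [disjoint v |: s & V'] by rewrite disjoint_setU1 !inE eqxx.
have [U sU aU sz|y yP] := IH (v |: s) W' disv subW' z.
  have vU : v \notin U by apply/negP => /(subsetP sU); rewrite (negbTE vW').
  have sUW : U \subset W by rewrite (subset_trans sU) ?subsetDl.
  have aW : face (s :|: (W :\: U)) by rewrite -act1.
  have : bnd W z U = 0 by rewrite bndD cyc // bnd_bnd addr0.
  rewrite -[W in bnd W]defW bnd_setU1 // slz ?add0r //; last by case: sz.
  by apply: faceD aU; rewrite setSU // subsetUr.
pose y' U := if v \in U then 0 else y U.
exists (fun U => y' U - cone v t U) => U sU aU sz.
rewrite bndB; apply/eqP; rewrite -subr_eq opprK -/(z U); apply/eqP.
case: (boolP (v \in U)) => vU.
  rewrite [RHS]bnd0 => [|u _ _]; last by rewrite /y' !inE vU orbT.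
  have vU0 : v \notin U :\ v by rewrite !inE eqxx.
  have := @slz (U :\ v); rewrite /slice setD1K // => /(_ _ _ _)/(congr1 (fun x => inc_sign R v (U :\ v) * x)).
  rewrite mulrA inc_sign_sqr mul1r mulr0; apply.
  - exact: setSD.
  - by rewrite -act2 setD1K.
  - by move: sz; rewrite (cardsD1 v) vU => -[].
have sU' : U \subset W' by rewrite subsetD1 sU.
rewrite -[W in bnd W]defW bnd_setU1 // {1}/slice /y' setU11 mulr0 add0r.
rewrite yP // ?act1 //; apply: eq_bnd => u uW uU; rewrite !inE (negbTE vU) orbF.
by case: eqP => // e; rewrite e uW in vW'.
Qed.

End Rigidity.

(** * The clique complex *)

Section CliqueComplex.
Variables (R : comNzRingType) (n d : nat).
Implicit Types (C D A : {set {set 'I_n}}) (e F U W s : {set 'I_n}).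

(* The Stanley-Reisner complex of the circuit ideal of the complement of [C]. *)
Definition face C s : bool :=
  [forall T : {set 'I_n}, (T \subset s) && (#|T| == d) ==> (T \in C)].

Lemma faceP C s :
  reflect (forall T : {set 'I_n}, T \subset s -> #|T| = d -> T \in C) (face C s).
Proof.
apply: (iffP forallP) => [fs T sT /eqP cT|fs T].
  by move: (fs T); rewrite sT cT.
by apply/implyP => /andP[sT /eqP cT]; apply: fs.
Qed.

Lemma faceS C s s' : s \subset s' -> face C s' -> face C s.
Proof.
by move=> sub /faceP fs; apply/faceP => T sT; apply: fs; apply: subset_trans sub.
Qed.

Lemma face_small C s : (#|s| < d)%N -> face C s.
Proof.
move=> lt_s; apply/faceP => T sT cT.
by move: (subset_leq_card sT); rewrite cT leqNgt lt_s.
Qed.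

(* The multidegree [W] part of the Koszul complex of the face ring: [U] is the
   exterior part and [W :\: U] the support of the coefficient, so that this is the
   cochain complex of the faces contained in [W]. *)
Definition koszul_exact C W p := exact_at R (fun U => face C (W :\: U)) W p.

(** Here [W :\: U] has at most [d - 2] vertices, so giving [w] back to it leaves fewer than [d] and
    always yields a face. *)
Lemma koszul_exact_low C W p : W != set0 -> (#|W|.+2 <= p + d)%N -> koszul_exact C W p.
Proof.
move=> /set0Pn[w wW] le_W; apply: (exact_at_cone wW) => U sU aU sz wU.
apply: face_small; move: (cardsD W (U :\ w)) (cardsD1 w U) (subset_leq_card sU).
rewrite wU (setIidPr _) ?(subset_trans _ sU) ?subsetDl //; lia.
Qed.

Lemma koszul_exact0 C W : W != set0 -> koszul_exact C W 0.
Proof.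
move=> /set0Pn[w wW]; apply: (exact_at_cone wW) => U _ _ /cards0_eq->.
by rewrite inE.
Qed.

Lemma not_koszul_exact00 C : (0 < d)%N -> ~ koszul_exact C set0 0.
Proof.
move=> d0 /(_ (fun=> 1))[//|y /(_ set0)].
rewrite sub0set setD0 face_small ?cards0 // => /(_ isT isT erefl)/esym.
by rewrite bnd0 => [/esym/eqP|v]; rewrite ?oner_eq0 ?inE.
Qed.

Lemma koszul_exact_rigid C p : (forall W, koszul_exact C W p) ->
  forall W, koszul_exact C W p.+1.
Proof.
move=> ex W; apply: (@eq_exact_at _ _ (fun U => face C (set0 :|: (W :\: U)))).
  by move=> U _; rewrite set0U.
(* With all the variables in [V], disjointness forces [s] to be empty, and the hypothesis is the one
   at hand. *)
apply: (@exact_at_rigid _ _ _ _ setT) => //.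
- exact: faceS.
- move=> s W1; rewrite disjoint_sym disjoints_subset => dis _.
  suff -> : s = set0.
    by apply: eq_exact_at (ex W1) => U _; rewrite set0U.
  apply/eqP; rewrite -subset0 -setCS setC0 //.
- by rewrite disjoint_sym disjoints_subset setC0.
Qed.

(** * Removing one circuit through a simplicial set *)

Section RemoveCircuit.
Variables (C : {set {set 'I_n}}) (e F : {set 'I_n}).
Hypotheses (simpl_e : simplicial d C e) (FC : F \in C) (cardF : #|F| = d) (sub_eF : e \subset F).
Local Notation D := (C :\ F).
Local Notation N := (clnbhd C e).

Lemma card_simplicial : #|e|.+1 = d. Proof. by case: simpl_e. Qed.

Lemma circuit_ext : exists2 v, v \notin e & F = v |: e.
Proof.
have /set0Pn[v] : F :\: e != set0.
  by rewrite -card_gt0 cardsD (setIidPr sub_eF) cardF -card_simplicial subSn // subnn.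
rewrite inE => /andP[ve vF]; exists v => //; apply/esym/eqP.
rewrite eqEcard subUset sub1set vF sub_eF cardsU1 ve.
by rewrite cardF -card_simplicial add1n leqnn.
Qed.

Lemma circuit_sub_clnbhd : F \subset N.
Proof.
have [v ve defF] := circuit_ext; rewrite defF subUset sub1set !inE -defF FC orbT.
exact: subsetUl.
Qed.

Lemma face_remove s : face D s = face C s && ~~ (F \subset s).
Proof.
apply/faceP/andP => [fs|[/faceP fs nF] T sT cT].
  split; last by apply/negP => /fs/(_ cardF); rewrite !inE eqxx.
  by apply/faceP => T sT cT; move: (fs T sT cT); rewrite inE => /andP[].
by rewrite !inE fs // andbT; apply: contraNneq nF => <-.
Qed.

Lemma face_sub_clnbhd s : face C s -> F \subset s -> s \subset N.
Proof.
move=> /faceP fs Fs; apply/subsetP => x xs; rewrite !inE.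
case: (boolP (x \in e)) => //= xe; apply: fs.
  by rewrite subUset sub1set xs (subset_trans sub_eF).
by rewrite cardsU1 xe add1n card_simplicial.
Qed.

Lemma face_in_clnbhd s : s \subset N -> face C s.
Proof.
move=> sN; apply/faceP => T sT cT; have [_ [ltN|]] := simpl_e.
  by move: (subset_leq_card circuit_sub_clnbhd); rewrite cardF leqNgt ltN.
by apply => //; apply: subset_trans sT sN.
Qed.

(** Allows a set [A] of circuits to be removed one at a time. Without [F = v |: e] the vertex [v]
    leaves the closed neighbourhood of [e], whose subsets are then different from [F]. *)
Lemma simplicial_remove : simplicial d D e.
Proof.
split; first exact: card_simplicial; right => T sT cT.
have [v ve defF] := circuit_ext.
rewrite !inE; apply/andP; split.
  apply/eqP => defT; move: (subsetP sT v); rewrite defT defF setU11 !inE.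
  by rewrite (negbTE ve) -defF eqxx => /(_ isT).
apply: (faceP _ _ (face_in_clnbhd _)) cT => //; apply: subset_trans sT _.
rewrite subUset subsetUl; apply/subsetP => x; rewrite !inE => /andP[_ ->].
by rewrite orbT.
Qed.

Variables (W : {set 'I_n}) (p : nat).
Hypothesis le_W : (p + d <= #|W|)%N.

(* The faces of [C] that are not faces of [D] form the interval [F, N :&: W],
   which is acyclic when it is not reduced to [F]. *)
Let Q U := (F \subset W :\: U) && (W :\: U \subset N).

Lemma faceQ U : face C (W :\: U) = face D (W :\: U) || Q U.
Proof.
rewrite face_remove /Q; apply/idP/orP => [fU|[/andP[]//|/andP[_ /face_in_clnbhd//]]].
rewrite fU; case: (boolP (F \subset _)) => sF; last by left.
by right; apply: face_sub_clnbhd.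
Qed.

Lemma notQ U : face D (W :\: U) -> ~~ Q U.
Proof. by rewrite face_remove /Q => /andP[_ /negbTE->]. Qed.

(** Functions supported on [Q] thus have zero boundary at the faces of [D]: they form the kernel of
    the restriction from the complex of [C] to that of [D]. *)
Lemma notQU1 v U : face D (W :\: U) -> ~~ Q (v |: U).
Proof.
move=> fU; apply: notQ; apply: faceS fU.
by rewrite setDUr subsetIr.
Qed.

Section Cone.
Variable w : 'I_n.
Hypotheses (wW : w \in W) (wN : w \in N) (wF : w \notin F).

(** The homotopy of [w] survives truncation to [Q]. If [v |: U] leaves [Q], then [v] is in [F], and
    [cone w c] there is zero or reads [c] at a set whose complement is a face of [D], where [c]
    vanishes. *)
Lemma bnd_coneQ c U : Q U ->
  (forall U', U' \subset W -> face D (W :\: U') -> #|U'| = #|U| -> c U' = 0) -> U \subset W ->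
  bnd W (fun V => if Q V then cone w c V else 0 : R) U = c U - cone w (bnd W c) U.
Proof.
move=> QU c0 sU; rewrite -(bnd_cone c U wW) addrK.
apply: eq_bnd => v vW vU; case: ifPn => // nQ; rewrite /cone; case: ifPn => // wvU.
have vw : v != w.
  apply: contraNneq nQ => ->; move: QU => /andP[sF sN].
  rewrite /Q setDUr; apply/andP; split; last by apply: subset_trans sN; apply: subsetIr.
  rewrite subsetI sF andbT; apply/subsetP => x xF; rewrite !inE.
  move: (subsetP sF x xF); rewrite inE => /andP[_ ->].
  by rewrite andbT; apply: contraNneq wF => <-.
rewrite c0 ?mulr0 //.
- apply: subset_trans (subsetDl _ _) _; by rewrite subUset sub1set vW.
- move: QU => /andP[sF sN].
  have vF : v \in F.
    apply: contraNT nQ => vF; rewrite /Q setDUr subsetI sF andbT.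
    rewrite (subset_trans (subsetIr _ _) sN) andbT.
    apply/subsetP => x xF; move: (subsetP sF x xF); rewrite !inE => /andP[_ ->].
    by rewrite andbT; apply: contraNneq vF => <-.
  rewrite face_remove face_in_clnbhd /=.
    by apply/negP => /subsetP/(_ v vF); rewrite !inE eqxx vw.
  apply/subsetP => x; rewrite in_setD in_setD1 negb_and negbK => /andP[/orP[/eqP->//|]].
  rewrite in_setU1 negb_or => /andP[xv xU] xW; apply: (subsetP sN).
  by rewrite inE xU.
- by move: (cardsD1 w (v |: U)); rewrite wvU cardsU1 vU => -[].
Qed.

Lemma QD1 U : Q U -> Q (U :\ w).
Proof.
move=> /andP[sF sN]; rewrite /Q; apply/andP; split.
  by apply: subset_trans sF _; rewrite setDS // subsetDl.
apply/subsetP => x; rewrite in_setD in_setD1 negb_and negbK.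
move=> /andP[/orP[/eqP->//|xU] xW]; by apply: (subsetP sN); rewrite inE xU.
Qed.

Lemma koszul_exact_remove_cone : koszul_exact C W p <-> koszul_exact D W p.
Proof.
split=> ex c cyc.
  (* The obstruction to [c] being a cycle for [C] is [bnd W c] on [Q]; subtracting [q] cancels it
     and leaves [c] unchanged on the faces of [D]. *)
  pose q U := if Q U then cone w (bnd W c) U else 0 : R.
  have [U sU aU sz|y yP] := ex (fun U => c U - q U).
    rewrite bndB; move: aU; rewrite faceQ => /orP[aU|QU].
      by rewrite cyc // bnd0 ?subr0 // => v _ _; rewrite /q (negbTE (notQU1 _ aU)).
    rewrite [X in _ - X](bnd_coneQ (c := bnd W c)) // => [|U' sU' aU' cU'].
      have -> : cone w (bnd W (bnd W c)) U = 0.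
        by rewrite /cone; case: ifP => //; rewrite bnd_bnd mulr0.
      by rewrite subr0 subrr.
    by apply: cyc => //; rewrite cU'.
  exists y => U sU aU sz; rewrite -yP //; last by rewrite faceQ aU.
  by rewrite /q (negbTE (notQ aU)) subr0.
have [U sU aU sz|y yP] := ex c; first by apply: cyc => //; rewrite faceQ aU.
(* This defect vanishes on the faces of [D], so its truncated cone is the missing part of the
   primitive. *)
pose c' U := c U - bnd W y U.
exists (fun U => y U + (if Q U then cone w c' U else 0)) => U sU aU sz.
rewrite bndD; apply/eqP; rewrite addrC -subr_eq -/(c' U); apply/eqP.
move: aU; rewrite faceQ => /orP[aU|QU].
  rewrite bnd0 => [|v _ _]; last by rewrite (negbTE (notQU1 _ aU)).
  by rewrite /c' yP ?subrr.
rewrite bnd_coneQ // => [|U' sU' aU']; last by rewrite sz /c' => /yP->; rewrite ?subrr.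
rewrite /cone; case: ifP => [wU|]; rewrite ?subr0 //.
rewrite bndB bnd_bnd subr0 cyc ?mulr0 ?subr0 //.
- by apply: subset_trans sU; apply: subsetDl.
- by rewrite faceQ QD1 ?orbT.
- by move: sz; rewrite (cardsD1 w U) wU.
Qed.

End Cone.

(** An elementary collapse: within [W] the only circuit through [e] is [F], and [Q] is reduced to
    the set [W :\: F]. *)
Lemma koszul_exact_remove_facet : F \subset W -> W :&: N \subset F ->
  koszul_exact C W p <-> koszul_exact D W p.
Proof.
move=> sFW sNF.
have QE U : U \subset W -> Q U -> U = W :\: F.
  move=> sU /andP[sF sN].
  have -> : F = W :\: U.
    by apply/eqP; rewrite eqEsubset sF; apply: subset_trans sNF; rewrite subsetI subsetDl.
  by rewrite setDDr setDv set0U (setIidPr sU).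
have cU0 : #|W :\: F| = (#|W| - d)%N by rewrite cardsD (setIidPr sFW) cardF.
split=> ex c cyc.
  have [U sU aU sz|y yP] := ex c; last first.
    by exists y => U sU aU sz; apply: yP => //; rewrite faceQ aU.
  (* The exceptional set [W :\: F] has at least [p] elements, while cycles are tested on sets of
     size [p - 1]. *)
  apply: cyc => //; move: aU; rewrite faceQ => /orP[//|/(QE _ sU) defU].
  by move: sz; rewrite defU cU0; lia.
have [U sU aU sz|y yP] := ex c; first by apply: cyc => //; rewrite faceQ aU.
have [v ve defF] := circuit_ext.
(* The defect [a] sits at the single set of [Q]. As [v |: U0] is the complement of the free face
   [e], a function supported there has boundary at no other face than [F]. *)
pose U0 := W :\: F; pose a : R := c U0 - bnd W y U0.
have vU0 : v \notin U0 by rewrite inE defF setU11.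
pose b U := if U == v |: U0 then inc_sign R v U0 * a else 0.
have vW : v \in W by apply: (subsetP sFW); rewrite defF setU11.
exists (fun U => y U + b U) => U sU aU sz; rewrite bndD.
case: (U =P U0) => [->|nU0].
  have vWU0 : v \in W :\: U0 by rewrite in_setD vU0.
  rewrite [X in _ + X]/bnd (bigD1 v) //= /b eqxx mulrA inc_sign_sqr mul1r.
  rewrite big1 ?addr0 ?subrKC // => u; rewrite in_setD => /andP[/andP[uU uW] uv].
  case: eqP => [e1|]; last by rewrite mulr0.
  by move: (setU11 u U0); rewrite e1 in_setU1 (negbTE uv) (negbTE uU).
have fU : face D (W :\: U).
  by move: aU; rewrite faceQ => /orP[//|/(QE _ sU)].
rewrite yP // [X in _ + X]bnd0 ?addr0 // => u uW uU; rewrite /b; case: eqP => // e1.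
case: nU0; have uv : u = v.
  have: u |: e \in C.
    apply: (faceP _ _ aU); last first.
      rewrite cardsU1 (_ : u \notin e) ?add1n ?card_simplicial //.
      move: (setU11 u U); rewrite e1 /U0 defF !inE.
      case: (u =P v) => [->|_ /=]; first by rewrite ve.
      by case/andP.
    apply/subsetP => x; rewrite !inE => /orP[/eqP->|xe]; first by rewrite uU.
    rewrite (subsetP sFW) ?(subsetP sub_eF) // andbT.
    have: x \notin v |: U0.
      rewrite !inE (subsetP sub_eF) // orbF; apply: contraNneq ve => <-.
      exact: xe.
    by rewrite -e1 !inE negb_or => /andP[].
  move=> ueC; have: u \in F by apply: (subsetP sNF); rewrite !inE uW ueC orbT.
  rewrite defF !inE => /orP[/eqP//|ue].
  by move: (setU11 u U); rewrite e1 /U0 defF !inE ue orbT /= orbF => /eqP.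
by rewrite uv in e1 uU; rewrite -(setU1K uU) e1 setU1K.
Qed.

Lemma koszul_exact_remove : koszul_exact C W p <-> koszul_exact D W p.
Proof.
case: (boolP (F \subset W)) => [sFW|nFW]; last first.
  have e1 U : U \subset W -> face C (W :\: U) = face D (W :\: U).
    move=> _; rewrite face_remove (_ : F \subset _ = false) ?andbT //.
    by apply: contraNF nFW => /subset_trans->//; apply: subsetDl.
  by split; apply: eq_exact_at => U sU; rewrite e1.
case: (boolP (W :&: N \subset F)) => [|/subsetPn[w]]; first exact: koszul_exact_remove_facet.
by rewrite inE => /andP[wW wN] wF; apply: koszul_exact_remove_cone wF.
Qed.

End RemoveCircuit.

Lemma koszul_exact_simplicial_elim C D l W p : uniform d C -> simplicial_elim d C l D ->
  (p + d <= #|W|)%N -> koszul_exact C W p <-> koszul_exact D W p.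
Proof.
move=> + + le_W; elim: l C => [|[e A] l IH] C unifC /=; first by move=> ->; split.
case=> simp; move: {2}#|A| (erefl #|A|) => m.
elim: m C A unifC simp => [|m IHm] C A unifC simp.
  by move/cards0_eq-> => _; rewrite setD0; apply: IH.
move=> cA; have /set0Pn[F FA] : A != set0 by rewrite -card_gt0 cA.
move=> sA elim1; have: F \in [set F0 in C | e \subset F0] by apply: (subsetP sA).
rewrite inE => /andP[FC eF].
rewrite (koszul_exact_remove simp FC (unifC _ FC) eF le_W).
apply: (IHm _ (A :\ F)).
- by move=> G; rewrite inE => /andP[_ /unifC].
- exact: simplicial_remove (unifC _ FC) _.
- by move: cA; rewrite (cardsD1 F) FA => -[].
- apply/subsetP => G; rewrite !inE => /andP[GF GA].
  by move: (subsetP sA G GA); rewrite !inE GF.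
- suff -> : (C :\ F) :\: (A :\ F) = C :\: A by [].
  by rewrite setDDl setD1K.
Qed.

End CliqueComplex.

(** * Taylor and Koszul complexes *)

Section Monomials.
Variables (K : fieldType) (n : nat).
Local Notation S := {mpoly K[n]}.
Implicit Types (m b : 'X_{1..n}) (p : S) (s : {set 'I_n}).

Definition mset s : 'X_{1..n} := [multinom (i \in s : nat) | i < n].
Definition mnm_supp b : {set 'I_n} := [set i | (0 < b i)%N].

Lemma msetE s i : mset s i = (i \in s) :> nat. Proof. exact: mnmE. Qed.

Lemma mset_le s b : (mset s <= b)%MM = (s \subset mnm_supp b).
Proof.
apply/mnm_lepP/subsetP => [le_sb i si|sb i].
  by move: (le_sb i); rewrite msetE si inE.
by rewrite msetE; case: (boolP (i \in s)) => // /sb; rewrite inE.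
Qed.

Lemma mdeg_mset s : mdeg (mset s) = #|s|.
Proof.
rewrite mdegE -sum1_card [in RHS]big_mkcond; apply: eq_bigr => i _.
by rewrite msetE; case: ifP.
Qed.

Lemma mnm_supp_mset s : mnm_supp (mset s) = s.
Proof. by apply/setP => i; rewrite inE msetE lt0b. Qed.

Lemma mset_setD s s' : (mset (s :\: s') + mset s')%MM = mset (s :|: s').
Proof.
apply/mnmP => i; rewrite mnmDE !msetE !inE.
by case: (i \in s); case: (i \in s').
Qed.

Lemma mcoeffXM m p b :
  ('X_[m] * p)@_b = if (m <= b)%MM then p@_(b - m)%MM else 0.
Proof.
case: ifPn => [le_mb|nle].
  by rewrite -[in LHS](submK le_mb) addmC mulrC mcoeffMX.
apply/eqP; rewrite mulrC mcoeff_eq0 (perm_mem (msuppMX p m)).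
by apply: contra nle => /mapP[m' _ ->]; apply: lem_addr.
Qed.

Lemma mcoeff_bounded (E : 'X_{1..n} -> K) m k :
  (\sum_(m' : 'X_{1..n < k}) (E m' *: 'X_[m'] : S))@_m = if (mdeg m < k)%N then E m else 0.
Proof.
case: ifPn => [|nlt]; first exact: mcoeff_mpoly.
rewrite raddf_sum /= big1 // => -[m' lt_m'] _ /=; rewrite mcoeffZ mcoeffX.
by case: eqP => [e|_]; rewrite ?mulr0 //; rewrite e (negbTE nlt) in lt_m'.
Qed.

End Monomials.

(* The Taylor complex of the squarefree monomials [a v], with coefficients in
   a free module: an element of homological degree [i] is given by its
   coordinates on the subsets of size [i] of [T].  The Koszul complex is the
   case of the variables, [a v = [set v]]. *)
Section Taylor.
Variables (K : fieldType) (n : nat) (T : finType) (a : T -> {set 'I_n}).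
Local Notation S := {mpoly K[n]}.
Implicit Types (m b : 'X_{1..n}) (s : {set T}) (f g : {set T} -> S).

Definition label s : {set 'I_n} := \bigcup_(v in s) a v.

(** Up to sign, the lcm of the generators in [v |: s] divided by the lcm of those in [s]. *)
Definition taylor_coef v s : S := inc_sign K v s *: 'X_[mset (a v :\: label s)].

Definition sdif f s : S := \sum_(v | v \notin s) taylor_coef v s * f (v |: s).

Definition gens_below b : {set T} := [set v | a v \subset mnm_supp b].

(* The part of multidegree [b] of [f].  Subtraction of exponents being
   truncated, it only makes sense for [s \subset gens_below b]. *)
Definition mpart b f s : K := (f s)@_(b - mset (label s))%MM.

Lemma label_sub s b : (label s \subset mnm_supp b) = (s \subset gens_below b).
Proof.
apply/bigcupsP/subsetP => [sb v vs|sb v /sb]; last by rewrite inE.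
by rewrite inE; apply: sb.
Qed.

Lemma labelU1 v s : label (v |: s) = a v :|: label s.
Proof. by rewrite /label setUC bigcup_setU big_set1 setUC. Qed.

(** In a fixed multidegree the monomial coefficients become 1, which leaves the simplex on the
    generators dividing [b]. *)
Lemma mpart_sdif b f s : s \subset gens_below b ->
  mpart b (sdif f) s = bnd (gens_below b) (mpart b f) s.
Proof.
move=> sb; have lb : (mset (label s) <= b)%MM by rewrite mset_le label_sub.
rewrite /mpart /sdif raddf_sum /bnd big_mkcond [RHS]big_mkcond /=.
apply: eq_bigr => v _; rewrite in_setD; case: ifP => //= vs.
rewrite /taylor_coef -scalerAl mcoeffZ mcoeffXM mset_le.
have -> : (a v :\: label s \subset mnm_supp (b - mset (label s))) = (v \in gens_below b).
  rewrite inE; apply/subsetP/subsetP => [sub i ia|sub i].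
    case: (boolP (i \in label s)) => il.
      by move: lb; rewrite mset_le => /subsetP/(_ i il).
    have: i \in a v :\: label s by rewrite in_setD il.
    move/sub; rewrite !inE mnmBE; lia.
  rewrite in_setD => /andP[il ia]; move: (sub i ia); rewrite !inE mnmBE msetE.
  by rewrite (negbTE il) subn0.
by case: ifP; rewrite ?mulr0 // => vb; rewrite submDA addmC mset_setD labelU1.
Qed.

Lemma mpart_label s m f : mpart (m + mset (label s)) f s = (f s)@_m.
Proof. by rewrite /mpart addmK. Qed.

Lemma sub_gens_below_label s m : s \subset gens_below (m + mset (label s)).
Proof. by rewrite -label_sub -mset_le lem_addl. Qed.

Lemma sdif_sdif f s : sdif (sdif f) s = 0.
Proof.
apply/mpolyP => m; rewrite mcoeff0 -mpart_label mpart_sdif ?sub_gens_below_label //.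
rewrite -[RHS](bnd_bnd (gens_below (m + mset (label s))) (mpart (m + mset (label s)) f) s).
apply: eq_bnd => v vb _; apply: mpart_sdif.
by rewrite subUset sub1set vb sub_gens_below_label.
Qed.

(** The predicate [act] serves two uses: it is trivial over S, and selects the monomials outside the
    ideal over S/I. *)
Lemma sdif_assemble (act : pred 'X_{1..n}) f p :
  (forall b, exists y, forall s, s \subset gens_below b -> act (b - mset (label s))%MM ->
     #|s| = p -> mpart b f s = bnd (gens_below b) y s) ->
  exists g, forall s, #|s| = p -> forall m, act m -> (f s)@_m = (sdif g s)@_m.
Proof.
(* Primitives chosen in infinitely many multidegrees need a cut-off to form polynomials. A basis
   element has degree at most [n], so no term of [f] reaches total degree [D]. *)
move=> /choice[y yP]; pose D := ((\max_s msize (f s)) + n.+1)%N.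
have fD s m : (D <= mdeg (m + mset (label s)))%N -> (f s)@_m = 0.
  move=> leD; apply/eqP; rewrite mcoeff_eq0; apply/negP => /msize_mdeg_lt ltm.
  move: leD; rewrite mdegD mdeg_mset leqNgt => /negP; apply.
  have: (msize (f s) <= \max_s msize (f s))%N by apply: leq_bigmax.
  have: (#|label s| <= n)%N by rewrite -[leqRHS]card_ord max_card.
  by move: ltm; rewrite /D; lia.
pose E s m := if (mdeg (m + mset (label s)) < D)%N then y (m + mset (label s))%MM s else 0.
pose g s : S := \sum_(m : 'X_{1..n < D}) (E s m *: 'X_[m]).
have gE s m : (g s)@_m = E s m.
  rewrite /g mcoeff_bounded /E; case: ifPn => // nlt; case: ifP => // lt.
  by case/negP: nlt; apply: leq_ltn_trans lt; rewrite mdegD leq_addr.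
exists g => s sz m am; set b := (m + mset (label s))%MM.
have sb : s \subset gens_below b by apply: sub_gens_below_label.
rewrite -[in RHS]mpart_label -/b mpart_sdif //.
have gb v : v \in gens_below b -> mpart b g (v |: s) =
    if (mdeg b < D)%N then y b (v |: s) else 0.
  move=> vb; rewrite /mpart gE /E submK // mset_le label_sub.
  by rewrite subUset sub1set vb.
case: (ltnP (mdeg b) D) => ltD; last first.
  rewrite fD // bnd0 // => v vb _; rewrite gb // ltnNge ltD //.
rewrite -mpart_label -/b yP //; last by rewrite /b addmK.
by apply: eq_bnd => v vb _; rewrite gb // ltD.
Qed.

(** Each multidegree gives a full simplex, hence a contractible complex unless no generator divides
    [b]. Then only the empty set remains, which is what the hypothesis for [p = 0] excludes. *)
Lemma sdif_exact f p : (forall s, #|s|.+1 = p -> sdif f s = 0) ->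
  (p = 0%N -> forall m, m \in msupp (f set0) -> gens_below m != set0) ->
  exists g, forall s, #|s| = p -> f s = sdif g s.
Proof.
move=> cyc gen; have [b|g gP] := @sdif_assemble predT f p; last first.
  by exists g => s sz; apply/mpolyP => m; apply: gP.
case: (boolP (gens_below b == set0)) => [/eqP b0|/set0Pn[w wb]].
  exists (fun=> 0) => s; rewrite b0 subset0 => /eqP-> _; rewrite cards0 => p0.
  rewrite bnd0 // /mpart; apply/eqP; rewrite mcoeff_eq0; apply/negP => /(gen (esym p0)).
  have -> : (b - mset (label set0))%MM = b.
    by apply/mnmP => i; rewrite mnmBE msetE /label big_set0 inE subn0.
  by rewrite b0 eqxx.
have [||y yP] := @exact_at_cone T K predT (gens_below b) p w wb _ (mpart b f) => //.
  by move=> s sb _ sz; rewrite -mpart_sdif // /mpart cyc // mcoeff0.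
by exists y => s sb _ sz; apply: yP.
Qed.

Section Vectors.
Variable r : nat.
Implicit Types (F G : {set T} -> 'rV[S]_r).

Definition vdif F s : 'rV[S]_r := \sum_(v | v \notin s) taylor_coef v s *: F (v |: s).

Lemma vdif_coord F s k : vdif F s 0 k = sdif (fun s => F s 0 k) s.
Proof. by rewrite /vdif summxE; apply: eq_bigr => v _; rewrite mxE. Qed.

Lemma vdif_vdif F s : vdif (vdif F) s = 0.
Proof.
apply/rowP => k; rewrite mxE vdif_coord -[RHS](sdif_sdif (fun s => F s 0 k) s).
by apply: eq_bigr => v _; rewrite vdif_coord.
Qed.

Lemma eq_vdif F G s : (forall s', #|s'| = #|s|.+1 -> F s' = G s') ->
  vdif F s = vdif G s.
Proof.
by move=> e; apply: eq_bigr => v vs; rewrite e // cardsU1 vs add1n.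
Qed.

Lemma vdifB F G s : vdif (fun s => F s - G s) s = vdif F s - vdif G s.
Proof. by rewrite -sumrB; apply: eq_bigr => v _; rewrite scalerBr. Qed.

Lemma vdifD F G s : vdif (fun s => F s + G s) s = vdif F s + vdif G s.
Proof. by rewrite -big_split; apply: eq_bigr => v _; rewrite scalerDr. Qed.

Lemma vdif_exact F p : (forall s, #|s|.+1 = p -> vdif F s = 0) ->
  (p = 0%N -> forall k m, m \in msupp (F set0 0 k) -> gens_below m != set0) ->
  exists G, forall s, #|s| = p -> F s = vdif G s.
Proof.
move=> cyc gen.
have /fin_all_exists[g gP] k : exists g, forall s, #|s| = p -> F s 0 k = sdif g s.
  apply: (@sdif_exact (fun s => F s 0 k)) => [s sz|p0 m]; last exact: gen.
  by rewrite -vdif_coord cyc // mxE.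
exists (fun s => \row_k g k s) => s sz; apply/rowP => k.
rewrite gP // vdif_coord; apply: eq_bigr => v _; by rewrite mxE.
Qed.

End Vectors.

Lemma vdif_mulmx r r' (F : {set T} -> 'rV[S]_r) (A : 'M[S]_(r, r')) s :
  vdif F s *m A = vdif (fun s => F s *m A) s.
Proof. by rewrite mulmx_suml; apply: eq_bigr => v _; rewrite scalemxAl. Qed.

End Taylor.

Lemma fin_all_exists_on (T : finType) (U : nmodType) (A : pred T) (P : T -> U -> Prop) :
  (forall x, A x -> exists u, P x u) -> exists u, forall x, A x -> P x (u x).
Proof.
move=> ex; apply: (@fin_all_exists T (fun=> U) (fun x u => A x -> P x u)) => x.
case: (boolP (A x)) => [/ex[u Pu]|nA]; first by exists u.
by exists 0.
Qed.

(** * Homogeneous components of polynomials and of vectors *)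

Section Projection.
Variables (K : fieldType) (n : nat).
Local Notation S := {mpoly K[n]}.
Implicit Types (a j : int) (p q : S).

Definition hproj a p : S :=
  \sum_(m : 'X_{1..n < msize p}) ((if (mdeg m)%:Z == a then p@_m else 0) *: 'X_[m]).

Lemma mcoeff_hproj a p m : (hproj a p)@_m = if (mdeg m)%:Z == a then p@_m else 0.
Proof.
rewrite (mcoeff_bounded (fun m : 'X_{1..n} => if (mdeg m)%:Z == a then p@_m else 0)).
case: ltnP => // lem; case: ifP => // _; apply/esym/eqP; rewrite mcoeff_eq0.
by apply/negP => /msize_mdeg_lt; rewrite ltnNge lem.
Qed.

Lemma hproj0 a : hproj a 0 = 0.
Proof. by apply/mpolyP => m; rewrite mcoeff_hproj !mcoeff0; case: ifP. Qed.

Lemma hprojD a : {morph hproj a : p q / p + q}.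
Proof.
by move=> p q; apply/mpolyP => m; rewrite mcoeffD !mcoeff_hproj mcoeffD; case: ifP => // _; rewrite addr0.
Qed.

Lemma hprojB a : {morph hproj a : p q / p - q}.
Proof.
by move=> p q; apply/mpolyP => m; rewrite mcoeffB !mcoeff_hproj mcoeffB; case: ifP => // _; rewrite subr0.
Qed.

Lemma hproj_sum a (I : Type) (r : seq I) (P : pred I) (F : I -> S) :
  hproj a (\sum_(i <- r | P i) F i) = \sum_(i <- r | P i) hproj a (F i).
Proof. by apply: (big_morph _ (hprojD a) (hproj0 a)). Qed.

Lemma hprojK a p : hproj a (hproj a p) = hproj a p.
Proof. by apply/mpolyP => m; rewrite !mcoeff_hproj; case: (_ == a). Qed.

Lemma hproj_homog a p : Defs.homog a p -> hproj a p = p.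
Proof.
move=> hp; apply/mpolyP => m; rewrite mcoeff_hproj; case: eqP => // ne.
by apply/esym/eqP; rewrite mcoeff_eq0; apply/negP => /hp.
Qed.

Lemma homog_hproj a p : hproj a p = p -> Defs.homog a p.
Proof.
move=> e m; rewrite mcoeff_msupp -e mcoeff_hproj.
by case: ((mdeg m)%:Z =P a) => // _; rewrite eqxx.
Qed.

Lemma hprojM a a' p q : Defs.homog a' q -> hproj (a + a') (p * q) = hproj a p * q.
Proof.
move=> hq; apply/mpolyP => m; rewrite mcoeff_hproj !mcoeffM.
have dE (k1 k2 : 'X_{1..n}) : m == (k1 + k2)%MM ->
    q@_k2 != 0 -> ((mdeg m)%:Z == a + a') = ((mdeg k1)%:Z == a).
  by rewrite -mcoeff_msupp => /eqP-> /hq <-; rewrite mdegD PoszD (inj_eq (addIr _)).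
case: ifPn => [ma|nma]; last apply/esym/big1; first apply: eq_bigr.
  move=> k mk; case: (q@_k.2 =P 0) => [->|/eqP qk]; first by rewrite !mulr0.
  by rewrite mcoeff_hproj -(dE _ _ mk qk) ma.
move=> k mk; case: (q@_k.2 =P 0) => [->|/eqP qk]; first by rewrite mulr0.
by rewrite mcoeff_hproj -(dE _ _ mk qk) (negbTE nma) mul0r.
Qed.

Variable r : nat.
Implicit Types (deg : 'I_r -> int) (v : 'rV[S]_r).

(* The homogeneous component of degree [j] of a vector of the free module
   whose basis has the degrees [deg]. *)
Definition vproj deg j v : 'rV[S]_r := \row_k hproj (j - deg k) (v 0 k).

Lemma vprojK deg j v : vproj deg j (vproj deg j v) = vproj deg j v.
Proof. by apply/rowP => k; rewrite !mxE hprojK. Qed.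

Lemma vprojB deg j : {morph vproj deg j : u v / u - v}.
Proof. by move=> u v; apply/rowP => k; rewrite !mxE hprojB. Qed.

Lemma vproj0 deg j : vproj deg j 0 = 0.
Proof. by apply/rowP => k; rewrite !mxE hproj0. Qed.

Lemma vproj_sum deg j (I : Type) (s : seq I) (P : pred I) (F : I -> 'rV[S]_r) :
  vproj deg j (\sum_(i <- s | P i) F i) = \sum_(i <- s | P i) vproj deg j (F i).
Proof.
apply: (big_morph _ _ (vproj0 deg j)) => u v.
by apply/rowP => k; rewrite !mxE hprojD.
Qed.

Lemma vprojZ deg j a p v : Defs.homog a p -> vproj deg j (p *: v) = p *: vproj deg (j - a) v.
Proof.
move=> hp; apply/rowP => k; rewrite !mxE mulrC [RHS]mulrC -(hprojM _ _ hp).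
by congr hproj; ring.
Qed.

End Projection.

Lemma vproj_mulmx (K : fieldType) n r r' (deg : 'I_r -> int) (deg' : 'I_r' -> int) j
    (v : 'rV[{mpoly K[n]}]_r) (A : 'M[{mpoly K[n]}]_(r, r')) :
  (forall k l, Defs.homog (deg k - deg' l) (A k l)) ->
  vproj deg' j (v *m A) = vproj deg j v *m A.
Proof.
move=> hA; apply/rowP => l; rewrite !mxE hproj_sum; apply: eq_bigr => k _.
by rewrite mxE -(hprojM _ _ (hA k l)); congr hproj; ring.
Qed.

Section Koszul.
Variables (K : fieldType) (n : nat).
Local Notation S := {mpoly K[n]}.
Implicit Types (U V W : {set 'I_n}).

Local Notation kos := (fun v : 'I_n => [set v]).

Lemma label_koszul U : label kos U = U.
Proof.
apply/setP => x; apply/bigcupP/idP => [[v vU]|xU]; first by rewrite inE => /eqP->.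
by exists x; rewrite ?inE.
Qed.

Lemma gens_below_koszul b : gens_below kos b = mnm_supp b.
Proof. by apply/setP => x; rewrite !inE sub1set inE. Qed.

Lemma koszul_coef v U : v \notin U -> taylor_coef K kos v U = inc_sign K v U *: 'X_[mset [set v]].
Proof.
by move=> vU; rewrite /taylor_coef label_koszul; congr (_ *: 'X_[mset _]); apply/setDidPl; rewrite disjoints1.
Qed.

Lemma homog_koszul_coef v U : v \notin U -> Defs.homog 1 (taylor_coef K kos v U).
Proof.
move=> vU m; rewrite koszul_coef // mcoeff_msupp mcoeffZ mcoeffX.
by case: (_ =P m) => [<-|_]; rewrite ?mulr0 ?eqxx // mdeg_mset cards1.
Qed.

Lemma const_koszul_coef v U : v \notin U -> (taylor_coef K kos v U)@_0%MM = 0.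
Proof.
move=> vU; apply/eqP; rewrite mcoeff_eq0; apply/negP => /(homog_koszul_coef vU).
by rewrite mdeg0.
Qed.

Section Vectors.
Variables (r : nat) (deg : 'I_r -> int).
Implicit Types (F : {set 'I_n} -> 'rV[S]_r).

(** The shift accounts for the Koszul basis element of [U], of degree [#|U|]. *)
Definition kproj j F U := vproj deg (j - #|U|%:Z) (F U).

Lemma vdif_kproj j F U : vdif kos (kproj j F) U = vproj deg (j - #|U|%:Z) (vdif kos F U).
Proof.
rewrite /vdif vproj_sum; apply: eq_bigr => v vU.
rewrite (vprojZ _ _ _ (homog_koszul_coef vU)) /kproj; congr (_ *: vproj _ _ _).
by rewrite cardsU1 vU add1n; lia.
Qed.

Lemma const_vdif F U : map_mx (mcoeff 0%MM) (vdif kos F U) = 0.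
Proof.
apply/rowP => k; rewrite !mxE summxE raddf_sum /= big1 // => v vU.
by rewrite mxE rmorphM /= const_koszul_coef // mul0r.
Qed.

Lemma koszul_exact_const (u : 'rV[S]_r) : map_mx (mcoeff 0%MM) u = 0 ->
  exists g, u = vdif kos g set0.
Proof.
move=> u0; have [s|_ k m mu|g gP] := @vdif_exact K n _ kos r (fun=> u) 0 _ _.
- by [].
- rewrite gens_below_koszul; apply: contraTneq mu => supp0.
  have -> : m = 0%MM.
    apply/mnmP => i; move/setP/(_ i): supp0; rewrite !inE mnm0E; lia.
  by rewrite -mcoeff_eq0; move/rowP/(_ k): u0; rewrite !mxE => ->.
- by exists g; apply: gP; rewrite cards0.
Qed.

Lemma vdif_koszul_exact F p : (forall U, #|U| = p -> vdif kos F U = 0) ->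
  exists g, forall U, #|U| = p.+1 -> F U = vdif kos g U.
Proof. by move=> cyc; apply: vdif_exact => // U [] /cyc. Qed.

End Vectors.
End Koszul.

(** * Tor as Koszul homology *)

Section Balancing.
Variables (K : fieldType) (n : nat).
Local Notation S := {mpoly K[n]}.
Local Notation kos := (fun v : 'I_n => [set v]).
Local Notation const := (map_mx (mcoeff 0%MM)).
Variables (I : S -> Prop) (F : graded_free K n).
Hypothesis resF : is_graded_resolution I F.
Hypotheses (ideal0 : I 0) (idealD : forall f g : S, I f -> I g -> I (f + g))
  (idealM : forall f g : S, I g -> I (f * g))
  (ideal_hproj : forall a f, I f -> I (hproj a f)).
Implicit Types (U : {set 'I_n}) (q p i : nat) (j : int).

Lemma idealB (f g : S) : I f -> I g -> I (f - g).
Proof. by move=> If Ig; apply: idealD => //; rewrite -mulN1r; apply: idealM. Qed.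

Lemma ideal_sum (J : Type) (r : seq J) (P : pred J) (f : J -> S) :
  (forall k, P k -> I (f k)) -> I (\sum_(k <- r | P k) f k).
Proof. by move=> If; apply: (big_ind I). Qed.

Lemma dif_homog q k l : Defs.homog (@deg _ _ F q.+1 k - @deg _ _ F q l) (dif F q k l).
Proof. by case: resF => -[_ hd] _; apply: hd. Qed.

Lemma aug_homog k (l : 'I_1) : Defs.homog (@deg _ _ F 0 k - 0) (aug F k l).
Proof. by case: resF => -[ha _] _; rewrite subr0 (ord1 l); apply: ha. Qed.

Lemma exact_dif q (v : 'rV_(rk F q.+1)) :
  v *m dif F q = 0 <-> exists w, v = w *m dif F q.+1.
Proof. by case: resF => _ [_ _]; apply. Qed.

Lemma exact_aug (v : 'rV_(rk F 0)) :
  I ((v *m aug F) 0 0) <-> exists w, v = w *m dif F 0.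
Proof. by case: resF => _ [_ +] _; apply. Qed.

Lemma dif_dif q (v : 'rV_(rk F q.+2)) : v *m dif F q.+1 *m dif F q = 0.
Proof. by apply/exact_dif; exists v. Qed.

Lemma mul_dif_inj q (v w : 'rV_(rk F q.+1)) : v *m dif F q = w *m dif F q ->
  exists u, v = w + u *m dif F q.+1.
Proof.
move=> e; have /exact_dif[u eu] : (v - w) *m dif F q = 0 by rewrite mulmxBl e subrr.
by exists u; rewrite -eu addrC subrK.
Qed.

Lemma const_mul r r' (v : 'rV[S]_r) (A : 'M[S]_(r, r')) :
  const (v *m A) = const v *m const A.
Proof. by rewrite map_mxM. Qed.

Definition cst r (v : 'rV[K]_r) : 'rV[S]_r := map_mx (@mpolyC n K) v.

Lemma cstK r (v : 'rV[K]_r) : const (cst v) = v.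
Proof. by apply/rowP => k; rewrite !mxE mcoeffC eqxx mulr1. Qed.

Lemma vproj_cst r (dg : 'I_r -> int) j (v : 'rV[K]_r) :
  (forall k, v 0 k != 0 -> dg k = j) -> vproj dg j (cst v) = cst v.
Proof.
move=> hv; apply/rowP => k; rewrite !mxE; apply/mpolyP => m.
rewrite mcoeff_hproj mcoeffC; case: eqP => // ne.
case: (v 0 k =P 0) => [->|/eqP/hv dk]; first by rewrite mul0r.
case: (m =P 0%MM) => [m0|]; last by rewrite mulr0.
by rewrite m0 mdeg0 dk subrr in ne.
Qed.

(* Vanishing in degree [j] of the [p]-th Koszul homology of the cokernel of
   [dif F q], the [q]-th syzygy module of S/I. *)
Definition syz_exact q p j := forall f : {set 'I_n} -> 'rV[S]_(rk F q),
  (forall U, kproj (@deg _ _ F q) j f U = f U) ->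
  (forall U, #|U|.+1 = p -> exists w, vdif kos f U = w *m dif F q) ->
  exists g, forall U, #|U| = p -> exists w, f U = vdif kos g U + w *m dif F q.

(* The same for S/I, with S seen as the row vectors of length 1. *)
Definition quo_exact p j := forall z : {set 'I_n} -> 'rV[S]_1,
  (forall U, kproj (fun=> 0) j z U = z U) ->
  (forall U, #|U|.+1 = p -> I (vdif kos z U 0 0)) ->
  exists g, forall U, #|U| = p -> I ((z U - vdif kos g U) 0 0).

Definition tor_exact i j := forall v : 'rV[K]_(rk F i),
  (forall k, v 0 k != 0 -> deg k = j) -> res_cycle v -> res_boundary v.

Lemma kproj_mul q j (f : {set 'I_n} -> 'rV_(rk F q.+1)) U :
  kproj (@deg _ _ F q) j (fun V => f V *m dif F q) U = kproj (@deg _ _ F q.+1) j f U *m dif F q.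
Proof. by apply: vproj_mulmx => k l; apply: dif_homog. Qed.

(** The connecting isomorphism of 0 -> Syz_{q+1} -> F_q -> Syz_q -> 0: the free module F_q has no
    Koszul homology in positive degrees, whence [0 < p]. *)
Lemma syz_exact_shift q p j : (0 < p)%N -> syz_exact q p.+1 j <-> syz_exact q.+1 p j.
Proof.
move=> p0; split=> ex f fj cyc.
  have d0 U : #|U|.+1 = p -> vdif kos (fun V => f V *m dif F q) U = 0.
    by move=> /cyc[w e]; rewrite -vdif_mulmx e dif_dif.
  have [h hP] : exists h, forall U, #|U| = p -> f U *m dif F q = vdif kos h U.
    by case: p p0 d0 {ex cyc} => // p _ d0; apply: vdif_koszul_exact => U sz; rewrite d0 ?sz.
  (* The primitive [h] need not be homogeneous, but its component of degree [j] is still a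
     primitive. *)
  pose h' := kproj (@deg _ _ F q) j h.
  have h'P U : #|U| = p -> vdif kos h' U = f U *m dif F q.
    by move=> sz; rewrite vdif_kproj -hP // -[in RHS]fj -kproj_mul.
  have [U|U [sz]|g gP] := ex h'; first exact: vprojK.
    by exists (f U); apply: h'P.
  have [u uP] := fin_all_exists_on (A := fun U => #|U| == p.+1) (fun U sz => gP U (eqP sz)).
  exists u => U sz; apply: mul_dif_inj; rewrite vdif_mulmx -h'P //.
  rewrite (@eq_vdif _ _ _ _ _ _ (fun V => vdif kos g V + u V *m dif F q)).
    by rewrite vdifD vdif_vdif add0r.
  by move=> V sV; apply: uP; rewrite sV sz.
have [w wP] := fin_all_exists_on (A := fun U => #|U| == p) (fun U sz => cyc U (congr1 succn (eqP sz))).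
pose w' := kproj (@deg _ _ F q.+1) j w.
have w'P U : #|U| = p -> vdif kos f U = w' U *m dif F q.
  move=> /eqP sz; rewrite -kproj_mul /kproj -wP // -vdif_kproj.
  by apply: eq_vdif => V _; rewrite fj.
have [U|U sz|g gP] := ex w'; first exact: vprojK.
  apply/exact_dif; rewrite vdif_mulmx -[RHS](vdif_vdif kos f U).
  by apply: eq_vdif => V sV; rewrite w'P // sV.
have [u uP] := fin_all_exists_on (A := fun U => #|U| == p) (fun U sz => gP U (eqP sz)).
have [U sz|h hP] := @vdif_koszul_exact K n _ (fun U => f U - g U *m dif F q) p.
  rewrite vdifB w'P // -vdif_mulmx uP; last exact/eqP.
  by rewrite mulmxDl dif_dif addr0 subrr.
exists h => U sz; exists (g U); rewrite -hP // subrK //.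
Qed.

(** H_1 of Syz_q is the kernel of Syz_{q+1} (x) K -> F_q (x) K. Indeed [v] is a cycle modulo the
    variables exactly when [cst v *m dif F q] has no constant term, that is, when it is a Koszul
    boundary. *)
Lemma syz_exact_tor q j : syz_exact q 1 j <-> tor_exact q.+1 j.
Proof.
split=> [ex v vj vcyc|ex f fj cyc].
  have [|g gP] := @koszul_exact_const K n _ (cst v *m dif F q).
    by rewrite const_mul cstK.
  pose g' := kproj (@deg _ _ F q) j g.
  have g'P : vdif kos g' set0 = cst v *m dif F q.
    rewrite vdif_kproj -gP cards0 subr0 (vproj_mulmx _ _ (@dif_homog q)) vproj_cst //.
  have [U|U [/cards0_eq->]|h hP] := ex g'; first exact: vprojK.
    by exists (cst v).
  have [u uP] := fin_all_exists_on (A := fun U => #|U| == 1%N) (fun U sz => hP U (eqP sz)).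
  have [|w wP] := @mul_dif_inj q (cst v) (vdif kos u set0).
    rewrite -g'P (@eq_vdif _ _ _ _ _ _ (fun V => vdif kos h V + u V *m dif F q)).
      by rewrite vdifD vdif_vdif add0r vdif_mulmx.
    by move=> V; rewrite cards0 => /eqP; apply: uP.
  exists (const w); rewrite -[LHS]cstK wP -const_mul.
  by rewrite map_mxD const_vdif add0r.
have [|w wP] := cyc set0; first by rewrite cards0.
pose w' := vproj (@deg _ _ F q.+1) j w.
have w'P : vdif kos f set0 = w' *m dif F q.
  rewrite -(vproj_mulmx _ _ (@dif_homog q)) -wP.
  transitivity (vdif kos (kproj (@deg _ _ F q) j f) set0).
    by apply: eq_vdif => V _; rewrite fj.
  by rewrite vdif_kproj cards0 subr0.
have [|| u uP] := ex (const w').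
- move=> k; rewrite !mxE mcoeff_hproj mdeg0; case: ifP => [/eqP e _|_]; last by rewrite eqxx.
  by apply/esym/eqP; rewrite -subr_eq0 -e.
- by rewrite /= /res_dif -const_mul -w'P const_vdif.
have [|g gP] := @koszul_exact_const K n _ (w' - cst u *m dif F q.+1).
  by rewrite map_mxB const_mul cstK uP subrr.
have [U /cards0_eq->|h hP] := @vdif_koszul_exact K n _ (fun U => f U - g U *m dif F q) 0.
  by rewrite vdifB -vdif_mulmx -gP mulmxBl dif_dif subr0 -w'P subrr.
by exists h => U sz; exists (g U); rewrite -hP // subrK.
Qed.

Lemma syz_exact_tor0 j : syz_exact 0 0 j <-> tor_exact 0 j.
Proof.
split=> [ex v vj _|ex f fj _].
  pose f (U : {set 'I_n}) := if U == set0 then cst v else 0.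
  have [U||g gP] := ex f => //.
    rewrite /kproj /f; case: eqP => [->|_]; last exact: vproj0.
    by rewrite cards0 subr0 vproj_cst.
  have [|w] := gP set0; first by rewrite cards0.
  rewrite /f eqxx => e; exists (const w); rewrite -[LHS]cstK e map_mxD const_vdif add0r.
  by rewrite const_mul.
have [|| u uP] := ex (const (f set0)) => //.
  move=> k; rewrite -fj !mxE mcoeff_hproj mdeg0 cards0 subr0; case: ifP => [/eqP e _|_]; last by rewrite eqxx.
  by apply/esym/eqP; rewrite -subr_eq0 -e.
have [|g gP] := @koszul_exact_const K n _ (f set0 - cst u *m dif F 0).
  by rewrite map_mxB const_mul cstK uP subrr.
by exists g => U /cards0_eq->; exists (cst u); rewrite -gP subrK.
Qed.

Lemma aug_lift (z : 'rV[S]_1) : exists v : 'rV_(rk F 0), I ((z - v *m aug F) 0 0).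
Proof.
by case: resF => _ [/(_ (z 0 0))[v Iv] _ _]; exists v; rewrite mxE [X in _ + X]mxE.
Qed.

Lemma ideal_vdif (z : {set 'I_n} -> 'rV[S]_1) U :
  (forall V : {set 'I_n}, #|V| = #|U|.+1 -> I (z V 0 0)) -> I (vdif kos z U 0 0).
Proof.
move=> Iz; rewrite summxE; apply: ideal_sum => v vU; rewrite mxE; apply: idealM.
by apply: Iz; rewrite cardsU1 vU add1n.
Qed.

Lemma quo_exact_syz p j : quo_exact p j <-> syz_exact 0 p j.
Proof.
have hproj_aug (f : {set 'I_n} -> 'rV_(rk F 0)) U :
    kproj (fun=> 0) j (fun V => f V *m aug F) U = kproj (@deg _ _ F 0) j f U *m aug F.
  by apply: vproj_mulmx => k l; apply: aug_homog.
split=> [ex f fj cyc|ex z zj cyc].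
  have [U|U sz|g gP] := ex (fun U => f U *m aug F).
  - by rewrite hproj_aug fj.
  - by rewrite -vdif_mulmx; apply/exact_aug; apply: cyc.
  have [h hP] := fin_all_exists (fun U => aug_lift (g U)).
  exists h => U sz.
  have /exact_aug[w wP] : I (((f U - vdif kos h U) *m aug F) 0 0).
    have -> : (f U - vdif kos h U) *m aug F =
        (f U *m aug F - vdif kos g U) + vdif kos (fun V => g V - h V *m aug F) U.
      by rewrite mulmxBl vdif_mulmx vdifB addrA subrK.
    by rewrite mxE; apply: idealD; [apply: gP|apply: ideal_vdif].
  by exists w; rewrite -wP addrC subrK.
have [f fP] := fin_all_exists (fun U => aug_lift (z U)).
pose f' := kproj (@deg _ _ F 0) j f.
have f'P U : I ((z U - f' U *m aug F) 0 0).
  rewrite -zj -hproj_aug /kproj -vprojB mxE; exact: ideal_hproj.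
have [U|U sz|g gP] := ex f'; first exact: vprojK.
  apply/exact_aug; rewrite vdif_mulmx.
  have -> : vdif kos (fun s => f' s *m aug F) U =
      vdif kos z U - vdif kos (fun s => z s - f' s *m aug F) U.
    by rewrite vdifB opprB addrC subrK.
  by rewrite mxE [X in _ + X]mxE; apply: idealB; [apply: cyc|apply: ideal_vdif].
exists (fun U => g U *m aug F) => U sz; have [w wP] := gP U sz.
have -> : z U - vdif kos (fun V => g V *m aug F) U =
    (z U - f' U *m aug F) + w *m dif F 0 *m aug F.
  by rewrite wP mulmxDl vdif_mulmx opprD addrA subrK.
by rewrite mxE; apply: idealD => //; apply/exact_aug; exists w.
Qed.

(** Only the right side mentions [F], which gives the independence of the resolution. Column [i.+1]
    is reached by [i] shifts. *)
Lemma quo_exact_tor i j : quo_exact i j <-> tor_exact i j.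
Proof.
rewrite quo_exact_syz; case: i => [|i]; first exact: syz_exact_tor0.
rewrite -syz_exact_tor.
suff shift q : syz_exact q i.+1 j <-> syz_exact (q + i) 1 j by apply: shift.
elim: i q => [|i IH] q; first by rewrite addn0; split.
by rewrite syz_exact_shift // IH addSnnS; split.
Qed.

End Balancing.

(** * The Koszul homology of a circuit ideal *)

Section CircuitIdeal.
Variables (K : fieldType) (n : nat).
Local Notation S := {mpoly K[n]}.
Implicit Types (G : {set {set 'I_n}}) (T U : {set 'I_n}) (f g : S) (m : 'X_{1..n}).

Lemma sqfree_monomialE T : sqfree_monomial K T = 'X_[mset T].
Proof.
rewrite /sqfree_monomial mprodXE; congr 'X_[_]; apply/mnmP => i.
rewrite mnm_sumE msetE big_mkcond (bigD1 i) //= mnm1E eqxx big1 ?addn0.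
  by case: (i \in T).
by move=> k /negbTE ki; rewrite mnm1E ki; case: ifP.
Qed.

Lemma circuit_ideal0 G : circuit_ideal K G (0 : S).
Proof. by exists (fun=> 0); rewrite big1 // => T _; rewrite mul0r. Qed.

Lemma circuit_idealD G f g : circuit_ideal K G f -> circuit_ideal K G g -> circuit_ideal K G (f + g).
Proof.
move=> [h ->] [h' ->]; exists (fun T => h T + h' T).
by rewrite -big_split; apply: eq_bigr => T _; rewrite mulrDl.
Qed.

Lemma circuit_idealM G f g : circuit_ideal K G g -> circuit_ideal K G (f * g).
Proof.
move=> [h ->]; exists (fun T => f * h T); rewrite mulr_sumr.
by apply: eq_bigr => T _; rewrite mulrA.
Qed.

Lemma circuit_ideal_gen G T : T \in G -> circuit_ideal K G ('X_[mset T] : S).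
Proof.
move=> TG; exists (fun T' => (T' == T)%:R); rewrite (bigD1 T) //= eqxx mul1r.
rewrite sqfree_monomialE big1 ?addr0 // => T' /andP[_ /negbTE->].
by rewrite mul0r.
Qed.

Lemma circuit_idealP G f : circuit_ideal K G f <->
  forall m, m \in msupp f -> exists2 T, T \in G & T \subset mnm_supp m.
Proof.
split=> [[h ->] m|fG].
  rewrite mcoeff_msupp => fm.
  have [/exists_inP[T TG sT]|] := boolP [exists T in G, T \subset mnm_supp m]; first by exists T.
  move=> /exists_inPn nG; case/negP: fm; rewrite raddf_sum big1 //= => T /nG /negbTE nT.
  by rewrite sqfree_monomialE mulrC mcoeffXM mset_le nT.
rewrite [f]mpolyE big_seq; apply: (big_ind (circuit_ideal K G)).
- exact: circuit_ideal0.
- by move=> g g'; apply: circuit_idealD.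
move=> m /fG[T TG sT]; rewrite -mul_mpolyC; apply: circuit_idealM.
rewrite -(submK (_ : mset T <= m)%MM) ?mset_le // mpolyXD.
by apply: circuit_idealM; apply: circuit_ideal_gen.
Qed.

Lemma circuit_ideal_hproj G a f : circuit_ideal K G f -> circuit_ideal K G (hproj a f).
Proof.
move=> /circuit_idealP fG; apply/circuit_idealP => m.
rewrite mcoeff_msupp mcoeff_hproj; case: ifP => _; last by rewrite eqxx.
by rewrite -mcoeff_msupp; apply: fG.
Qed.

Variables (d : nat) (C : {set {set 'I_n}}).
Local Notation I := (circuit_ideal K (clutter_compl d C)).
Local Notation kos := (fun v : 'I_n => [set v]).

Lemma clutter_idealP f : I f <-> forall m, face d C (mnm_supp m) -> f@_m = 0.
Proof.
rewrite circuit_idealP; split=> fI m.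
  move=> fm; apply/eqP; rewrite mcoeff_eq0; apply/negP => /fI[T].
  by rewrite inE => /andP[/eqP cT /negP TC] sT; apply: TC; apply: (faceP _ _ _ fm).
rewrite mcoeff_msupp => fm; have: ~~ face d C (mnm_supp m).
  by apply: contraNN fm => /fI->.
rewrite negb_forall => /existsP[T]; rewrite negb_imply => /andP[/andP[sT cT] TC].
by exists T; rewrite // inE cT.
Qed.

Lemma quo_exact_koszul p (j : int) : quo_exact I p j <->
  forall W : {set 'I_n}, #|W|%:Z = j -> koszul_exact K d C W p.
Proof.
split=> [ex W cW c cyc|ex z zj cyc].
  pose f U : S := if U \subset W then c U *: 'X_[mset (W :\: U)] else 0.
  have dE U : sdif kos f U = if U \subset W then bnd W c U *: 'X_[mset (W :\: U)] else 0.
    case: ifPn => [sU|nU]; last first.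
      rewrite /sdif big1 // => v _; rewrite /f [_ \subset _](negbTE _) ?mulr0 //.
      by apply: contraNN nU; apply: subset_trans; apply: subsetUr.
    rewrite /bnd scaler_suml /sdif big_mkcond [RHS]big_mkcond; apply: eq_bigr => v _.
    rewrite in_setD; case: ifP => //= vU; rewrite /f subUset sub1set sU andbT.
    case: ifP => vW; rewrite ?mulr0 // koszul_coef ?vU //.
    rewrite -scalerAl -scalerAr scalerA -mpolyXD mulrC; congr (_ *: 'X_[_]).
    apply/mnmP => i; rewrite mnmDE !msetE !inE; case: (i =P v) => [->|//].
    by rewrite vU vW.
  have [U|U sz|g gP] := ex (fun U => \row_k f U).
  - apply/rowP => k; rewrite !mxE subr0; apply: hproj_homog => m.
    rewrite /f; case: ifP => sU; last by rewrite msupp0.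
    rewrite mcoeff_msupp mcoeffZ mcoeffX; case: (_ =P m) => [<- _|]; last by rewrite mulr0 eqxx.
    rewrite mdeg_mset -cW cardsD (setIidPr sU).
    by move: (subset_leq_card sU); lia.
  - rewrite vdif_coord; apply/clutter_idealP => m fm.
    have -> : sdif kos (fun s => (\row_(k < 1) f s) 0 0) U = sdif kos f U.
      by apply: eq_bigr => v _; rewrite mxE.
    rewrite dE; case: ifP => sU; last by rewrite mcoeff0.
    rewrite mcoeffZ mcoeffX; case: (_ =P m) => [e|]; last by rewrite mulr0.
    by rewrite cyc ?mul0r // -(mnm_supp_mset (W :\: U)) e.
  exists (mpart kos (mset W) (fun U => g U 0 0)) => U sU aU sz.
  have /clutter_idealP/(_ (mset (W :\: U))) := gP U sz.
  rewrite mnm_supp_mset => /(_ aU); rewrite !mxE mcoeffB vdif_coord /f sU.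
  rewrite mcoeffZ mcoeffX eqxx mulr1 => /eqP; rewrite subr_eq0 => /eqP->.
  have gW : gens_below kos (mset W) = W by rewrite gens_below_koszul mnm_supp_mset.
  rewrite -[X in bnd X]gW -mpart_sdif ?gW // /mpart label_koszul; congr mcoeff.
  by apply/mnmP => i; rewrite mnmBE !msetE inE; case: (i \in U); case: (i \in W).
pose f U := z U 0 0.
have [b|g gP] := @sdif_assemble K n _ kos (fun m => face d C (mnm_supp m)) f p; last first.
  exists (fun U => \row_k g U) => U sz; apply/clutter_idealP => m fm.
  rewrite !mxE mcoeffB vdif_coord -/(f U) gP //; apply/eqP; rewrite subr_eq0.
  by apply/eqP; congr mcoeff; apply: eq_bigr => v _; rewrite mxE.
have lb U : U \subset gens_below kos b -> (mset U <= b)%MM.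
  by rewrite gens_below_koszul mset_le.
case: ((mdeg b)%:Z =P j) => [bj|nbj]; last first.
  exists (fun=> 0) => U sU _ _; rewrite bnd0 // /mpart label_koszul /f -zj !mxE.
  rewrite mcoeff_hproj subr0; case: eqP => // e; case: nbj.
  by rewrite -(submK (lb U sU)) mdegD mdeg_mset PoszD e subrK.
have bcyc U : U \subset gens_below kos b -> face d C (mnm_supp (b - mset (label kos U))) ->
    #|U|.+1 = p -> bnd (gens_below kos b) (mpart kos b f) U = 0.
  move=> sU aU sz; rewrite -mpart_sdif //; move/clutter_idealP: (cyc U sz) => /(_ _ aU).
  by rewrite vdif_coord.
suff exb : exact_at K (fun U => face d C (mnm_supp (b - mset (label kos U))))
    (gens_below kos b) p.
  by have [y yP] := exb (mpart kos b f) bcyc; exists y.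
(* Multidegrees that are not squarefree are acyclic: if [w] has exponent at least 2, moving one
   factor [w] from the exterior part to the coefficient does not change the support of the
   latter. *)
case: (boolP [exists w, 1 < b w]%N) => [/existsP[w bw]|/existsPn sqf].
  apply: (@exact_at_cone _ _ _ _ _ w).
    by rewrite gens_below_koszul inE ltnW.
  move=> U _ + _ wU; congr is_true; congr (face d C); rewrite !label_koszul.
  apply/setP => i; rewrite !inE !mnmBE !msetE !inE; case: (i =P w) => [->|//] /=.
  by rewrite wU subn0 subn_gt0 bw (ltnW bw).
have bE : b = mset (mnm_supp b).
  by apply/mnmP => i; rewrite msetE inE; move: (sqf i); rewrite -leqNgt; case: (b i) => [|[]].
rewrite gens_below_koszul; apply: eq_exact_at (ex (mnm_supp b) _) => [U sU|].
  rewrite label_koszul; congr (face d C); apply/setP => i; rewrite !inE mnmBE msetE.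
  rewrite subn_gt0 {2}bE msetE inE; move: (sqf i).
  by case: (b i) => [|[]] //; case: (i \in U).
by rewrite -bj {2}bE mdeg_mset.
Qed.

End CircuitIdeal.

(** * The Taylor resolution *)

Lemma homog_taylor_coef (K : fieldType) n (T : finType) (a : T -> {set 'I_n}) v s :
  Defs.homog (#|label a (v |: s)|%:Z - #|label a s|%:Z) (taylor_coef K a v s).
Proof.
move=> m; rewrite mcoeff_msupp mcoeffZ mcoeffX.
case: (_ =P m) => [<- _|]; last by rewrite mulr0 eqxx.
rewrite mdeg_mset labelU1 cardsU cardsD.
have := subset_leq_card (subsetIl (a v) (label a s)); lia.
Qed.

Section TaylorResolution.
Variables (K : fieldType) (n : nat) (G : {set {set 'I_n}}).
Local Notation S := {mpoly K[n]}.
Local Notation T := {A : {set 'I_n} | A \in G}.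
Local Notation gen := (fun A : T => val A).
Implicit Types (s : {set T}) (f : {set T} -> S) (i : nat).

Definition layer i : {set {set T}} := [set s : {set T} | #|s| == i].

(** Written as a sum so as to be defined on every set, with value 0 outside the layer. *)
Definition of_vec i (w : 'rV[S]_#|layer i|) s : S :=
  \sum_k (enum_val k == s)%:R * w 0 k.

Definition to_vec i f : 'rV[S]_#|layer i| := \row_k f (enum_val k).

Lemma card_layer i (k : 'I_#|layer i|) : #|enum_val k| = i.
Proof. by have := enum_valP k; rewrite inE => /eqP. Qed.

Lemma of_vec_val i (w : 'rV[S]_#|layer i|) k : of_vec w (enum_val k) = w 0 k.
Proof.
rewrite /of_vec (bigD1 k) //= eqxx mul1r big1 ?addr0 // => l.
by rewrite (inj_eq enum_val_inj) => /negbTE->; rewrite mul0r.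
Qed.

Lemma layer_val i s : #|s| = i -> exists k : 'I_#|layer i|, s = enum_val k.
Proof.
move=> sz; have si : s \in layer i by rewrite inE sz.
by exists (enum_rank_in si s); rewrite enum_rankK_in.
Qed.

Lemma to_vecK i f s : #|s| = i -> of_vec (to_vec i f) s = f s.
Proof. by move=> /layer_val[k ->]; rewrite of_vec_val mxE. Qed.

Definition taylor_dif i : 'M[S]_(#|layer i.+1|, #|layer i|) :=
  \matrix_(k < #|layer i.+1|, l < #|layer i|) \sum_(v | v \notin enum_val l)
    taylor_coef K gen v (enum_val l) * (enum_val k == v |: enum_val l)%:R.

Definition taylor : graded_free K n :=
  @GradedFree K n (fun i => #|layer i|) (fun i k => #|label gen (enum_val k)|%:Z)
    taylor_dif (const_mx 1).

Lemma mul_taylor_dif i (w : 'rV[S]_#|layer i.+1|) l :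
  (w *m taylor_dif i) 0 l = sdif gen (of_vec w) (enum_val l).
Proof.
rewrite mxE; under eq_bigr do rewrite mxE mulr_sumr.
rewrite exchange_big; apply: eq_bigr => v _; rewrite mulr_sumr.
by apply: eq_bigr => k _; rewrite mulrCA [w 0 k * _]mulrC.
Qed.

Lemma of_vec_taylor_dif i (w : 'rV[S]_#|layer i.+1|) s : #|s| = i ->
  of_vec (w *m taylor_dif i) s = sdif gen (of_vec w) s.
Proof. by move=> /layer_val[k ->]; rewrite of_vec_val mul_taylor_dif. Qed.

Lemma eq_sdif f f' s : (forall s', #|s'| = #|s|.+1 -> f s' = f' s') ->
  sdif gen f s = sdif gen f' s.
Proof. by move=> e; apply: eq_bigr => v vs; rewrite e // cardsU1 vs add1n. Qed.

Lemma mul_aug_taylor (w : 'rV[S]_#|layer 0|) : (w *m aug taylor) 0 0 = of_vec w set0.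
Proof.
rewrite mxE; apply: eq_bigr => k _; rewrite mxE mulr1.
by rewrite (_ : enum_val k = set0) ?eqxx ?mul1r //; apply/eqP; rewrite -cards_eq0 card_layer.
Qed.

Lemma label0 : label gen set0 = set0.
Proof. by rewrite /label big_set0. Qed.

Lemma taylor_exact_lift i (v : 'rV[S]_#|layer i|) :
  (exists g, forall s, #|s| = i -> of_vec v s = sdif gen g s) ->
  exists w, v = w *m taylor_dif i.
Proof.
move=> [g gP]; exists (to_vec i.+1 g); apply/rowP => l.
rewrite mul_taylor_dif -of_vec_val gP ?card_layer //.
by apply: eq_sdif => s; rewrite card_layer => sz; rewrite to_vecK.
Qed.

Lemma taylor_resolution : is_graded_resolution (circuit_ideal K G) taylor.
Proof.
split; first split.
- move=> k m; rewrite /= mxE msupp1 inE => /eqP->.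
  rewrite (_ : enum_val k = set0) ?label0 ?cards0 ?mdeg0 //.
  by apply/eqP; rewrite -cards_eq0 card_layer.
- move=> i k l; apply: homog_hproj; rewrite /= mxE hproj_sum; apply: eq_bigr => v vs.
  case: eqP => [->|_]; last by rewrite mulr0 hproj0.
  by rewrite mulr1; apply: hproj_homog; apply: homog_taylor_coef.
split.
- move=> f; exists (to_vec 0 (fun=> f)); rewrite mul_aug_taylor to_vecK ?cards0 //.
  by rewrite subrr; apply: circuit_ideal0.
- move=> v; rewrite mul_aug_taylor; split=> [Iv|[w ->]].
    apply: taylor_exact_lift; apply: sdif_exact => // _ m mv.
    move/circuit_idealP/(_ m mv): Iv => [A AG sA]; apply/set0Pn.
    by exists (exist _ A AG); rewrite inE.
  rewrite of_vec_taylor_dif ?cards0 // /sdif.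
  apply: (big_ind (circuit_ideal K G)); first exact: circuit_ideal0.
    by move=> f g; apply: circuit_idealD.
  move=> u _; rewrite mulrC; apply: circuit_idealM; rewrite /taylor_coef label0 setD0.
  by rewrite -mul_mpolyC; apply: circuit_idealM; apply: circuit_ideal_gen; apply: valP.
move=> i v; split=> [v0|[w ->]].
  apply: taylor_exact_lift; apply: sdif_exact => // s [sz].
  by rewrite -of_vec_taylor_dif // /= in v0 *; rewrite v0 /of_vec big1 // => k _; rewrite mxE mulr0.
apply/rowP => l; rewrite mul_taylor_dif mxE.
rewrite (@eq_sdif _ (sdif gen (of_vec w))) ?sdif_sdif // => s.
by rewrite card_layer; apply: of_vec_taylor_dif.
Qed.

End TaylorResolution.

(** * Comparison of the Betti tables *)

Section TorKoszul.
Variables (K : fieldType) (n d : nat) (C : {set {set 'I_n}}).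
Local Notation I := (circuit_ideal K (clutter_compl d C)).

Lemma tor_exact_koszul (F : graded_free K n) i (j : int) : is_graded_resolution I F ->
  tor_exact F i j <-> forall W : {set 'I_n}, #|W|%:Z = j -> koszul_exact K d C W i.
Proof.
move=> resF; rewrite -quo_exact_koszul; apply: iff_sym.
apply: (quo_exact_tor resF).
- exact: circuit_ideal0.
- by move=> f g; apply: circuit_idealD.
- by move=> f g; apply: circuit_idealM.
- by move=> a f; apply: circuit_ideal_hproj.
Qed.

Lemma Tor_neq0_koszul i (j : int) : Tor_neq0 I i j <->
  exists2 W : {set 'I_n}, #|W|%:Z = j & ~ koszul_exact K d C W i.
Proof.
split=> [[F resF [v [vj vc vb]]]|[W cW nex]]; apply: contrapT => nT.
  apply: vb; apply: ((tor_exact_koszul i j resF).2 _ v vj vc) => W cW.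
  by apply: contrapT => nex; apply: nT; exists W.
have resT := @taylor_resolution K n (clutter_compl d C).
apply: nex; move: W cW; apply/(tor_exact_koszul i j resT) => v vj vc.
by apply: contrapT => vb; apply: nT; exists (taylor K (clutter_compl d C)) => //; exists v.
Qed.

(** A resolution of length less than [i] has rank 0 at [i], and Tor may be computed on it. *)
Lemma Tor_neq0_le_pd i (j : int) : Tor_neq0 I i j -> le_pd i I.
Proof.
move=> /Tor_neq0_koszul[W cW nex] F p resF rk0; rewrite leqNgt; apply/negP => /rk0 rki.
apply: nex; move: W cW; apply/(tor_exact_koszul i j resF) => v _ _.
by exists 0; apply/rowP => k; move: (leq_trans (ltn_ord k) (eq_leq rki)).
Qed.

End TorKoszul.

Lemma int_max (P : int -> Prop) (b : int) : (forall j, P j -> j <= b) ->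
  (exists j, P j) -> exists2 m, P m & forall j, P j -> j <= m.
Proof.
move=> ub [j Pj]; have ex : exists k : nat, asbool (P (b - k%:Z)).
  exists `|b - j|%N; apply/asboolP; rewrite (_ : b - _ = j) //.
  by have := ub j Pj; lia.
case: (ex_minnP ex) => k /asboolP Pk kmin; exists (b - k%:Z) => // l Pl.
have := kmin `|b - l|%N; have := ub l Pl => lb; have -> : b - `|b - l|%N%:Z = l by lia.
move=> /(_ (asboolT Pl)); lia.
Qed.

Lemma emax_eq (A : extended int -> Prop) x : A x -> (forall y, A y -> (y <= x)%O) -> emax A = x.
Proof.
move=> Ax ub; apply: classical_sets.xget_unique => [//|y [Ay uby]].
by apply: le_anti; rewrite ub ?uby.
Qed.

Section TorShape.
Variables (K : fieldType) (n d : nat).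
Local Notation S := {mpoly K[n]}.

(* The features of the Betti table of S/I used in the comparison: a single
   column in degree 0, all other columns bounded, below the linear strand of
   degree [d] and without gaps. *)
Definition tor_shape (I : S -> Prop) : Prop :=
  [/\ forall j, Tor_neq0 I 0 j <-> j = 0,
      forall i j, (0 < i)%N -> Tor_neq0 I i j -> (i + d)%:Z <= j + 1,
      forall i j, Tor_neq0 I i j -> j <= n,
      forall i j, Tor_neq0 I i.+1 j -> exists j', Tor_neq0 I i j' &
      forall i j, Tor_neq0 I i j -> le_pd i I].

Section Shape.
Variables (I : S -> Prop).
Hypothesis shI : tor_shape I.

Definition is_tmax i m := Tor_neq0 I i m /\ forall j, Tor_neq0 I i j -> j <= m.

Lemma tmaxE i m : is_tmax i m -> tmax I i = EFin m.
Proof.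
by move=> [Tm ub]; apply: emax_eq => [|y [j Tj ->]]; [exists m|rewrite lee_fin ub].
Qed.

Lemma tmax_ex i j : Tor_neq0 I i j -> exists m, is_tmax i m.
Proof.
have [_ _ ub _ _] := shI => Tj.
by have [|m Tm mub] := int_max (ub i); [exists j|exists m].
Qed.

Lemma rmaxE i m : is_tmax i m -> rmax I i = EFin (m - i%:Z).
Proof. by rewrite /rmax => /tmaxE->. Qed.

Lemma tmax_cases i : tmax I i = ENInf _ \/ exists m, is_tmax i m.
Proof.
case: (pselect (exists j, Tor_neq0 I i j)) => [[j /tmax_ex]|none]; [by right|left].
by rewrite /tmax /emax; case: classical_sets.xgetP => // y _ [[j Tj _] _]; case: none; exists j.
Qed.

Lemma is_tmax0 : is_tmax 0 0.
Proof. by have [T0 _ _ _ _] := shI; split=> [|j]; rewrite T0 // => ->. Qed.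

Lemma tor_no_gap i k j : (k <= i)%N -> Tor_neq0 I i j -> exists j', Tor_neq0 I k j'.
Proof.
have [_ _ _ gap _] := shI; elim: i j => [|i IH] j; rewrite leq_eqVlt => /predU1P[->|//].
- by exists j.
- by exists j.
- by rewrite ltnS => ki /gap[j' Tj']; apply: IH Tj'.
Qed.

Lemma tmax_low i m : (0 < i)%N -> is_tmax i m -> (i + d)%:Z <= m + 1.
Proof. by have [_ low _ _ _] := shI => i0 [Tm _]; apply: low. Qed.

Lemma regE : exists2 c, reg I = EFin c &
  (exists i, is_tmax i (c + i%:Z)) /\ forall i j, Tor_neq0 I i j -> j - i%:Z <= c.
Proof.
have [_ _ ub _ _] := shI.
have [c [i Ti] cub] : exists2 c, (exists i, Tor_neq0 I i (c + i%:Z)) &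
    forall c', (exists i, Tor_neq0 I i (c' + i%:Z)) -> c' <= c.
  apply: (@int_max _ n) => [c [i /ub]|]; first by lia.
  by exists 0, 0%N; rewrite addr0; case: is_tmax0.
have cub' k j : Tor_neq0 I k j -> j - k%:Z <= c by move=> Tj; apply: cub; exists k; rewrite subrK.
have tm : is_tmax i (c + i%:Z) by split=> // j /cub'; lia.
exists c; last by split=> //; exists i.
apply: emax_eq => [|y [k ->]]; first by exists i; rewrite (rmaxE tm) addrK.
rewrite /rmax; case: (tmax_cases k) => [->|[m tk]]; first exact: leNye.
by rewrite (tmaxE tk) lee_fin; apply: cub'; case: tk.
Qed.

End Shape.

Variables (I J : S -> Prop).
Hypotheses (d0 : (0 < d)%N) (shI : tor_shape I) (shJ : tor_shape J).
Hypothesis IJ : forall i j, (i + d)%:Z <= j -> Tor_neq0 I i j <-> Tor_neq0 J i j.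

(** Above the linear strand [a] is also a degree of [J]; otherwise [a <= i + d - 1], which the top
    of any non-zero column attains. *)
Lemma tmax_le i a b : (0 < i)%N -> is_tmax I i a -> is_tmax J i b -> a <= b.
Proof.
move=> i0 [Ta _] tb; case: (leP (i + d)%:Z a) => [/IJ/iffLR/(_ Ta)|lta].
  by case: tb => _; apply.
have := tmax_low shJ i0 tb; lia.
Qed.

Lemma subadditive_transfer : subadditive I -> subadditive J.
Proof.
move=> subI i j pdJ; case: (posnP i) => [->|i0].
  by rewrite add0n (tmaxE (is_tmax0 shJ)) add0e lexx.
case: (posnP j) => [->|j0]; first by rewrite addn0 (tmaxE (is_tmax0 shJ)) adde0 lexx.
case: (tmax_cases shJ (i + j)) => [->|[m tm]]; first exact: leNye.
have [Tm _] := tm.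
have [|x /(tmax_ex shJ)[a ta]] := tor_no_gap shJ (k := i) _ Tm; first exact: leq_addr.
have [|y /(tmax_ex shJ)[b tb]] := tor_no_gap shJ (k := j) _ Tm; first exact: leq_addl.
rewrite (tmaxE tm) (tmaxE ta) (tmaxE tb) -EFinD lee_fin.
(* On the linear strand the bound is automatic: i + j + d - 1 <= (i + d - 1) + (j + d - 1), because
   d >= 1. *)
case: (leP (i + j + d)%:Z m) => [lem|ltm]; last first.
  by have := tmax_low shJ i0 ta; have := tmax_low shJ j0 tb; lia.
have Tm' : Tor_neq0 I (i + j) m by apply/IJ.
have [_ _ _ _ /(_ _ _ Tm')/subI] := shI.
have [m' tm'] := tmax_ex shI Tm'.
have [|x' /(tmax_ex shI)[a' ta']] := tor_no_gap shI (k := i) _ Tm'; first exact: leq_addr.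
have [|y' /(tmax_ex shI)[b' tb']] := tor_no_gap shI (k := j) _ Tm'; first exact: leq_addl.
rewrite (tmaxE tm') (tmaxE ta') (tmaxE tb') -EFinD lee_fin.
have := tmax_le i0 ta' ta; have := tmax_le j0 tb' tb; have := (tm'.2 _ Tm'); lia.
Qed.

Lemma reg_le c c' : reg I = EFin c -> reg J = EFin c' -> d%:Z <= c -> c <= c'.
Proof.
have [c1 -> [[i [Ti _]] _]] := regE shI; have [c2 -> [_ ub]] := regE shJ.
move=> [<-] [<-] dc; have /ub : Tor_neq0 J i (c1 + i%:Z) by apply/IJ => //; lia.
by rewrite addrK.
Qed.

End TorShape.

(** * Transfer of special Betti diagrams *)

Section SpecialBetti.
Variables (K : fieldType) (n d : nat) (I J : {mpoly K[n]} -> Prop).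
Hypotheses (d0 : (0 < d)%N) (shI : tor_shape d I) (shJ : tor_shape d J).
Hypothesis IJ : forall i j, (i + d)%:Z <= j -> Tor_neq0 I i j <-> Tor_neq0 J i j.

Let JI i j : (i + d)%:Z <= j -> Tor_neq0 J i j <-> Tor_neq0 I i j.
Proof. by move=> lej; apply: iff_sym; apply: IJ. Qed.

(** Without gaps, column [k] is non-zero on both sides too, and [tmax_le] applies in both
    directions. *)
Lemma rmax_eq i j k l : Tor_neq0 I i j -> Tor_neq0 J i l -> (k <= i)%N -> rmax I k = rmax J k.
Proof.
move=> Tj Tl ki; case: (posnP k) => [->|k0].
  by rewrite (rmaxE (is_tmax0 shI)) (rmaxE (is_tmax0 shJ)).
have [x /(tmax_ex shI)[a ta]] := tor_no_gap shI ki Tj.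
have [y /(tmax_ex shJ)[b tb]] := tor_no_gap shJ ki Tl.
rewrite (rmaxE ta) (rmaxE tb); congr (EFin (_ - _)); apply: le_anti.
by rewrite (tmax_le d0 shJ IJ k0 ta tb) (tmax_le d0 shI JI k0 tb ta).
Qed.

(* When the regularity is below [d] the resolution is linear, and the diagram
   always has a special shape. *)
Lemma special_betti_linear c : reg J = EFin c -> c < d%:Z -> special_betti J.
Proof.
have [c1 cE [[i0 ti0] ub]] := regE shJ; rewrite cE => -[<-{c}] ltcd.
have cge0 : 0 <= c1 by have := ub 0%N 0 (is_tmax0 shJ).1; rewrite subr0.
have desc i : (0 < i)%N \/ c1 = 0 -> (rmax J i.+1 <= rmax J i)%O.
  move=> i0'; rewrite {1}/rmax; case: (tmax_cases shJ i.+1) => [->|[m tm]]; first exact: leNye.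
  have [|x /(tmax_ex shJ)[a ta]] := tor_no_gap shJ (k := i) _ tm.1; first exact: leqnSn.
  rewrite (tmaxE tm) (rmaxE ta) lee_fin; have := ub _ _ tm.1.
  case: (posnP i) i0' ta tm => [->|ipos] i0' ta tm.
    have := is_tmax0 shJ; case: i0' => // -> [T0 _]; have := ta.2 _ T0; lia.
  have := tmax_low shJ ipos ta; lia.
(* Regularity 0 is reached in column 0. A positive one is reached in a column [i0 > 0], so it equals
   [d - 1] and is reached already in column 1. *)
case: (c1 =P 0) => [c0|/eqP cn0].
  exists 0%N; split=> // [|i _ _]; last by apply: desc; right.
  by rewrite (rmaxE (is_tmax0 shJ)) cE c0 subr0.
have i0pos : (0 < i0)%N.
  rewrite lt0n; apply: contraNneq cn0 => e; rewrite e addr0 in ti0.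
  by have [T0 _ _ _ _] := shJ; apply/eqP/T0; case: ti0.
have lec := tmax_low shJ i0pos ti0.
have [x /(tmax_ex shJ)[a ta]] := tor_no_gap shJ i0pos ti0.1.
have aE : a - 1 = c1 by have := tmax_low shJ (isT : (0 < 1)%N) ta; have := ub _ _ ta.1; lia.
exists 1%N; split.
- by rewrite (rmaxE ta) cE aE.
- by case=> // _; rewrite (rmaxE (is_tmax0 shJ)) cE subr0 => -[e]; rewrite -e eqxx in cn0.
- by case=> // _; rewrite (rmaxE (is_tmax0 shJ)) (rmaxE ta) aE lee_fin subr0.
- by move=> i i1 _; apply: desc; left.
Qed.

Lemma special_betti_transfer : special_betti I -> special_betti J.
Proof.
have [c cE [_ ubI]] := regE shI; have [c' c'E [_ ubJ]] := regE shJ.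
case: (ltP c' d%:Z) => [ltc' _|lec']; first exact: special_betti_linear c'E ltc'.
have lecc' := reg_le d0 shJ shI JI c'E cE lec'.
have {lecc'} ecc' : c' = c.
  by apply: le_anti; rewrite lecc' (reg_le d0 shI shJ IJ cE c'E) // (le_trans lec').
rewrite {c'}ecc' in c'E lec' ubJ; move=> [g [gc gmin mono desc]].
have tg : is_tmax I g (c + g%:Z).
  move: gc; rewrite cE {1}/rmax; case: (tmax_cases shI g) => [->//|[m tm]].
  by rewrite (tmaxE tm) => -[<-]; rewrite subrK.
(* As [c >= d], this corner lies above the linear strand and belongs to both tables, which then
   agree in all columns up to [g]. *)
have gJ : Tor_neq0 J g (c + g%:Z) by apply/IJ; [lia|case: tg].
have g0 : (0 < g)%N.
  rewrite lt0n; apply/eqP => e; rewrite e addr0 in tg.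
  by have [/(_ c)[/(_ tg.1)e0 _] _ _ _ _] := shI; lia.
have rE i : (i <= g)%N -> rmax I i = rmax J i by apply: rmax_eq tg.1 gJ.
exists g; split.
- by rewrite -rE // gc cE c'E.
- by move=> i ig; rewrite -rE 1?ltnW // c'E -cE; apply: gmin.
- by move=> i ig; rewrite -!rE // 1?ltnW //; apply: mono.
move=> i gi _; rewrite {1}/rmax; case: (tmax_cases shJ i.+1) => [->|[m tm]]; first exact: leNye.
have [Tm _] := tm.
case: (leP (i.+1 + d)%:Z m) => [lem|ltm].
  have Tm' : Tor_neq0 I i.+1 m by apply/IJ.
  rewrite -/(rmax J i.+1) -!(rmax_eq Tm' Tm) //; apply: desc => //.
  have [_ _ _ gap pd] := shI; have [j /pd] := gap _ _ Tm'; apply.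
(* Column [i.+1] of [J] stops at the linear strand, so its [rmax] is at most [d - 1], a lower bound
   for the non-zero column [i]. *)
have [|x /(tmax_ex shJ)[a ta]] := tor_no_gap shJ (k := i) _ Tm; first exact: leqnSn.
rewrite (tmaxE tm) (rmaxE ta) lee_fin.
have := tmax_low shJ (leq_trans g0 gi) ta; lia.
Qed.

End SpecialBetti.

Lemma tor_shape_circuit_ideal (K : fieldType) n d (C : {set {set 'I_n}}) : (0 < d)%N ->
  tor_shape d (circuit_ideal K (clutter_compl d C)).
Proof.
move=> d0; have exW0 i : (0 < i)%N -> koszul_exact K d C set0 i.
  by move=> i0; apply: exact_at_large; rewrite cards0.
split.
- move=> j; rewrite Tor_neq0_koszul; split=> [[W <-]|->]; last first.
    by exists set0; rewrite ?cards0 //; apply: not_koszul_exact00.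
  by case: (eqVneq W set0) => [->|W0 []]; [rewrite cards0|apply: koszul_exact0].
- move=> i j i0 /Tor_neq0_koszul[W <- nex]; rewrite leNgt; apply/negP => ltW.
  apply: nex; case: (eqVneq W set0) => [->|W0]; first exact: exW0.
  by apply: koszul_exact_low => //; lia.
- move=> i j /Tor_neq0_koszul[W <- _]; rewrite lez_nat -[leqRHS]card_ord; apply: max_card.
- move=> i j /Tor_neq0_koszul[W _ nex]; apply: contrapT => none; apply: nex.
  apply: koszul_exact_rigid => {}W; apply: contrapT => nex; apply: none.
  by exists #|W|%:Z; apply/Tor_neq0_koszul; exists W.
- exact: Tor_neq0_le_pd.
Qed.

Theorem corollary2p13 (K : fieldType) (n d : nat) (C D : {set {set 'I_n}})
    (unifC : uniform d C) (subD : simplicial_subclutter d D C) :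
  (subadditive (circuit_ideal K (clutter_compl d C)) <->
   subadditive (circuit_ideal K (clutter_compl d D))) /\
  (special_betti (circuit_ideal K (clutter_compl d C)) <->
   special_betti (circuit_ideal K (clutter_compl d D))).
Proof.
have [ltDC [s elim]] := subD.
(* The elimination is not empty because [D] is proper, and its first simplicial set has [d - 1]
   elements. *)
have d0 : (0 < d)%N.
  case: s elim => [/= e|[e A] s /= [[<- _] _ _] //].
  by rewrite e properxx in ltDC.
have shC := tor_shape_circuit_ideal K C d0; have shD := tor_shape_circuit_ideal K D d0.
have CD i j : (i + d)%:Z <= j -> Tor_neq0 (circuit_ideal K (clutter_compl d C)) i j <->
    Tor_neq0 (circuit_ideal K (clutter_compl d D)) i j.
  move=> lej; rewrite !Tor_neq0_koszul; split=> -[W cW nex]; exists W => // ex.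
    by apply/nex/(koszul_exact_simplicial_elim _ unifC elim) => //; rewrite -lez_nat cW.
  by apply/nex/(koszul_exact_simplicial_elim _ unifC elim) => //; rewrite -lez_nat cW.
have DC i j (lej : (i + d)%:Z <= j) := iff_sym (CD i j lej).
split; split.
- exact: subadditive_transfer d0 shC shD CD.
- exact: subadditive_transfer d0 shD shC DC.
- exact: special_betti_transfer d0 shC shD CD.
- exact: special_betti_transfer d0 shD shC DC.
Qed.
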